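(* Define a real number $\lambda \in \mathbb{R}$ by \[\lambda:=\Lambda\left(\left\{ \begin{pmatrix} 0&-2\\ \frac{1}{2}&0 \end{pmatrix}, \begin{pmatrix} 0 &-\frac{1}{2}\\ 2&0\end{pmatrix}\right\}\right)\] and define four matrices by \[A_0:=\begin{pmatrix}0&0\\0&-1\end{pmatrix},\quad A_1:=\begin{pmatrix}-1&1\\ -1&-1\end{pmatrix},\quad B_0:=\begin{pmatrix} -\lambda &-2\\ \frac{1}{2}&-\lambda \end{pmatrix},\quad B_1:=\begin{pmatrix} -\lambda &-\frac{1}{2}\\ 2&-\lambda\end{pmatrix}.\] Define three matrices $X_0, X_1, X_2 \in M_4(\mathbb{R})$ by \[X_0:=A_0 \otimes I + I\otimes B_0 =\begin{pmatrix} -\lambda&-2&0&0\\ \frac{1}{2}&-\lambda&0&0\\ 0&0&-\lambda-1&-2\\ 0&0&\frac{1}{2}&-\lambda-1 \end{pmatrix},\] \[X_1:=A_0 \otimes I + I \otimes B_1=\begin{pmatrix} -\lambda&-\frac{1}{2}&0&0\\ 2&-\lambda&0&0\\ 0&0&-\lambda-1&-\frac{1}{2}\\ 0&0&2&-\lambda-1 \end{pmatrix}, \] \[X_2:=A_1 \otimes I= \begin{pmatrix} -1&0&1&0\\ 0&-1&0&1\\ -1&0&-1&0\\ 0&-1&0&-1 \end{pmatrix} \] and let $\mathsf{X}\subset M_4(\mathbb{R})$ denote the convex hull of $\{X_0, X_1, X_2\}$. Then the linear switching system defined by $\mathsf{X}$ is irreducible and marginally stable, and every element of $\mathsf{X}$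 is a Hurwitz matrix. There exists a unique Barabanov norm for $\mathsf{X}$ up to scalar multiplication, and this norm is not strictly convex.
   Context: $M_d(\mathbb{R})$ is the space of real $d\times d$ matrices; $\|\cdot\|$ is the Euclidean norm; $I$ is the $2\times 2$ identity matrix; $A\otimes B$ is the Kronecker product (the block matrix whose $(i,j)$ block is $a_{ij}B$). A matrix is Hurwitz if all its eigenvalues have strictly negative real part. Let $\mathsf{A}\subset M_d(\mathbb{R})$ be compact and nonempty. A trajectory of the linear switching system defined by $\mathsf{A}$ is an absolutely continuous function $x\colon[0,\infty)\to\mathbb{R}^d$ satisfying $x'(t)=A(t)x(t)$ for a.e. $t\ge 0$ for some Lebesgue measurable $A\colon[0,\infty)\to\mathsf{A}$ (the switching law). The topological top Lyapunov exponent is \[\Lambda(\mathsf{A}):=\lim_{t\to\infty}\sup_x\frac1t\log\left(\frac{\|x(t)\|}{\|x(0)\|}\right),\] the supremum being over all trajectories $x$ with $x(0)\ne 0$ (the limit exists). The system is: exponentially stable if there are $C,\kappa>0$ with $\|x(t)\|\le Ce^{-\kappa t}\|x(0)\|$ for all $t\ge0$ and all trajectories $x$; exponentially unstable if there is a trajectory $x$ and $C,\kappa>0$ with $\|x(t)\|\ge Ce^{\kappa t}\|x(0)\|>0$ for all $t\ge 0$; marginally stable if it is neither exponentially stable nor exponentially unstable, but there is $C>0$ such that every trajectory satisfies $\|x(t)\|\le C\|x(0)\|$ for all $t\ge0$. $\mathsf{A}$ (or the system it defines) is reducible if there is a linear subspace $V\subset\mathbb{R}^d$ with $0<\dim V<d$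 and $AV\subseteq V$ for all $A\in\mathsf{A}$; otherwise it is irreducible. A norm $N$ on $\mathbb{R}^d$ is extremal for $\mathsf{A}$ if $t\mapsto e^{-t\Lambda(\mathsf{A})}N(x(t))$ is non-increasing on $[0,\infty)$ for every trajectory $x$. An extremal norm $N$ is a Barabanov norm for $\mathsf{A}$ if in addition for every $u\in\mathbb{R}^d$ there is a trajectory $x$ with $x(0)=u$ such that $e^{-t\Lambda(\mathsf{A})}N(x(t))$ is constant in $t\ge0$. Uniqueness up to scalar multiplication means that any two Barabanov norms for $\mathsf{A}$ are positive scalar multiples of one another. A norm is strictly convex if its unit sphere contains no line segment of positive length. *)

(* Defs.v *)
From HB Require Import structures.
From mathcomp Require Import all_boot all_order all_algebra.
From mathcomp Require Import mxtens complex.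
From mathcomp Require Import all_classical all_reals all_analysis.

Set Implicit Arguments.
Unset Strict Implicit.
Unset Printing Implicit Defensive.

Import Order.TTheory GRing.Theory Num.Theory.
Import numFieldNormedType.Exports.

Local Open Scope classical_set_scope.
Local Open Scope ring_scope.

(* The library norm `|v| on column vectors is the sup norm. *)
Definition enorm (R : realType) (d : nat) (v : 'cV[R]_d) : R :=
  Num.sqrt (\sum_(i < d) v i 0 ^+ 2).

Definition abs_continuous_on (R : realType) (d : nat) (a b : R)
    (x : R -> 'cV[R]_d) : Prop :=
  forall eps : R, 0 < eps -> exists2 delta : R, 0 < delta &
    forall (n : nat) (u v : 'I_n -> R),
      (forall i, a <= u i /\ u i <= v i /\ v i <= b) ->
      trivIset [set: 'I_n] (fun i => [set` `]u i, v i[]) ->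
      \sum_(i < n) (v i - u i) < delta ->
      \sum_(i < n) enorm (x (v i) - x (u i)) < eps.

(* The real line with its Lebesgue sigma-algebra: the Caratheodory-measurable
   sets of the outer measure that extends the length of intervals.  The
   library's default sigma-algebra on R is the Borel one. *)
Definition lebesgueType (R : realType) :=
  caratheodory_type (wlength (@idfun R))^*%mu.

(* A switching law on [0, +oo[ with values in AA; the values of A at negative
   times are irrelevant.  Measurability of a matrix-valued map is that of its
   entries. *)
Definition switching_law (R : realType) (d : nat) (AA : set 'M[R]_d)
    (A : R -> 'M[R]_d) : Prop :=
  (forall t, 0 <= t -> AA (A t)) /\
  (forall i j, measurable_fun ([set` `[0, +oo[] : set (lebesgueType R))
     (fun t : lebesgueType R => A t i j)).

(* Trajectories are total functions of which only the restriction to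
   [0, +oo[ matters; absolute continuity on [0, +oo[ is absolute continuity on
   every compact subinterval. *)
Definition trajectory (R : realType) (d : nat) (AA : set 'M[R]_d)
    (x : R -> 'cV[R]_d) : Prop :=
  (forall T, 0 <= T -> abs_continuous_on 0 T x) /\
  (exists2 A : R -> 'M[R]_d, switching_law AA A &
     {ae @lebesgue_measure R,
       forall t : R, 0 <= t -> is_derive t 1 x (A t *m x t)}).

(* For compact AA the set below is bounded, so that the real supremum is the
   genuine one. *)
Definition max_growth_rate (R : realType) (d : nat) (AA : set 'M[R]_d)
    (t : R) : R :=
  sup [set t^-1 * ln (enorm (x t) / enorm (x 0)) |
         x in [set x | trajectory AA x /\ x 0 != 0]].

Definition lyapunov_exponent (R : realType) (d : nat) (AA : set 'M[R]_d) : R :=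
  lim (max_growth_rate AA t @[t --> +oo]).

Definition exponentially_stable (R : realType) (d : nat)
    (AA : set 'M[R]_d) : Prop :=
  exists C kappa : R, [/\ 0 < C, 0 < kappa &
    forall x, trajectory AA x -> forall t, 0 <= t ->
      enorm (x t) <= C * expR (- (kappa * t)) * enorm (x 0)].

Definition exponentially_unstable (R : realType) (d : nat)
    (AA : set 'M[R]_d) : Prop :=
  exists (x : R -> 'cV[R]_d) (C kappa : R),
    [/\ trajectory AA x, 0 < C, 0 < kappa &
      forall t, 0 <= t ->
        C * expR (kappa * t) * enorm (x 0) <= enorm (x t) /\
        0 < C * expR (kappa * t) * enorm (x 0)].

Definition marginally_stable (R : realType) (d : nat)
    (AA : set 'M[R]_d) : Prop :=
  [/\ ~ exponentially_stable AA, ~ exponentially_unstable AA &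
    exists2 C : R, 0 < C &
      forall x, trajectory AA x -> forall t, 0 <= t ->
        enorm (x t) <= C * enorm (x 0)].

Definition reducible (R : realType) (d : nat) (AA : set 'M[R]_d) : Prop :=
  exists V : {vspace 'cV[R]_d}, (0 < \dim V < d)%N /\
    forall A, AA A -> forall v, v \in V -> A *m v \in V.

Definition irreducible (R : realType) (d : nat) (AA : set 'M[R]_d) : Prop :=
  ~ reducible AA.

Definition hurwitz (R : realType) (d : nat) (A : 'M[R]_d) : Prop :=
  forall z : R[i], eigenvalue (map_mx (real_complex R) A) z -> complex.Re z < 0.

Definition is_norm (R : realType) (d : nat) (N : 'cV[R]_d -> R) : Prop :=
  [/\ forall v, 0 <= N v,
      forall v, N v = 0 -> v = 0,
      forall (a : R) v, N (a *: v) = `|a| * N v &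
      forall v w, N (v + w) <= N v + N w].

Definition extremal_norm (R : realType) (d : nat) (AA : set 'M[R]_d)
    (N : 'cV[R]_d -> R) : Prop :=
  is_norm N /\
  forall x, trajectory AA x -> forall s t, 0 <= s -> s <= t ->
    expR (- (t * lyapunov_exponent AA)) * N (x t) <=
    expR (- (s * lyapunov_exponent AA)) * N (x s).

Definition barabanov_norm (R : realType) (d : nat) (AA : set 'M[R]_d)
    (N : 'cV[R]_d -> R) : Prop :=
  extremal_norm AA N /\
  forall u, exists2 x, trajectory AA x & x 0 = u /\
    exists c, forall t, 0 <= t ->
      expR (- (t * lyapunov_exponent AA)) * N (x t) = c.

Definition strictly_convex (R : realType) (d : nat)
    (N : 'cV[R]_d -> R) : Prop :=
  ~ exists u v : 'cV[R]_d, u != v /\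
      forall s : R, 0 <= s <= 1 -> N ((1 - s) *: u + s *: v) = 1.

Definition convex_hull (R : realType) (M : lmodType R) (S : set M) : set M :=
  smallest (@convex_set R M) S.

Definition mx_of_rows (R : realType) (m n : nat) (rows : seq (seq R)) :
    'M[R]_(m, n) :=
  \matrix_(i < m, j < n) (nth [::] rows i)`_j.

Definition lam (R : realType) : R :=
  lyapunov_exponent
    [set mx_of_rows 2 2 [:: [:: 0; -2]; [:: 2^-1; 0]];
         mx_of_rows 2 2 [:: [:: 0; - 2^-1]; [:: 2; 0]]].

Definition mxA0 (R : realType) : 'M[R]_2 :=
  mx_of_rows 2 2 [:: [:: 0; 0]; [:: 0; -1]].

Definition mxA1 (R : realType) : 'M[R]_2 :=
  mx_of_rows 2 2 [:: [:: -1; 1]; [:: -1; -1]].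

Definition mxB0 (R : realType) : 'M[R]_2 :=
  mx_of_rows 2 2 [:: [:: - lam R; -2]; [:: 2^-1; - lam R]].

Definition mxB1 (R : realType) : 'M[R]_2 :=
  mx_of_rows 2 2 [:: [:: - lam R; - 2^-1]; [:: 2; - lam R]].

(* tensmx, written *t, is the Kronecker product: block (i, j) of A *t B is
   A i j *: B. *)
Definition mxX0 (R : realType) : 'M[R]_4 :=
  mxA0 R *t (1%:M : 'M[R]_2) + (1%:M : 'M[R]_2) *t mxB0 R.

Definition mxX1 (R : realType) : 'M[R]_4 :=
  mxA0 R *t (1%:M : 'M[R]_2) + (1%:M : 'M[R]_2) *t mxB1 R.

Definition mxX2 (R : realType) : 'M[R]_4 :=
  mxA1 R *t (1%:M : 'M[R]_2).

Lemma mxX0E (R : realType) : mxX0 R = mx_of_rows 4 4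
  [:: [:: - lam R; -2; 0; 0];
      [:: 2^-1; - lam R; 0; 0];
      [:: 0; 0; - lam R - 1; -2];
      [:: 0; 0; 2^-1; - lam R - 1]].
Proof.
rewrite /mxX0 /mxA0 /mxB0; move: (lam R) => l.
apply/matrixP => i j; rewrite !mxE.
by case: i => -[|[|[|[|?]]]] ? //; case: j => -[|[|[|[|?]]]] ? //=;
  rewrite !(mulr1n, mulr0n, mul0r, mulr0, mul1r, mulr1, add0r, addr0) // addrC.
Qed.

Lemma mxX1E (R : realType) : mxX1 R = mx_of_rows 4 4
  [:: [:: - lam R; - 2^-1; 0; 0];
      [:: 2; - lam R; 0; 0];
      [:: 0; 0; - lam R - 1; - 2^-1];
      [:: 0; 0; 2; - lam R - 1]].
Proof.
rewrite /mxX1 /mxA0 /mxB1; move: (lam R) => l.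
apply/matrixP => i j; rewrite !mxE.
by case: i => -[|[|[|[|?]]]] ? //; case: j => -[|[|[|[|?]]]] ? //=;
  rewrite !(mulr1n, mulr0n, mul0r, mulr0, mul1r, mulr1, add0r, addr0) // addrC.
Qed.

Lemma mxX2E (R : realType) : mxX2 R = mx_of_rows 4 4
  [:: [:: -1; 0; 1; 0];
      [:: 0; -1; 0; 1];
      [:: -1; 0; -1; 0];
      [:: 0; -1; 0; -1]].
Proof.
apply/matrixP => i j; rewrite !mxE.
by case: i => -[|[|[|[|?]]]] ? //; case: j => -[|[|[|[|?]]]] ? //=;
  rewrite !(mulr1n, mulr0n, mul0r, mulr0, mul1r, mulr1, add0r, addr0).
Qed.

Definition hullX (R : realType) : set 'M[R]_4 :=
  convex_hull [set mxX0 R; mxX1 R; mxX2 R].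

Arguments hullX : clear implicits.

(* Main.v *)
(* Write [lam] for the exponent of the planar pair [C_0, C_1].  In "elliptic"
   polar coordinates one finds a function (here [gauge], homogeneous of degree
   2) that is nonincreasing along both flows [exp (t (C_i - lam))] and constant
   along a periodic orbit which switches on two orthogonal lines; [lam] is the
   solution of the resulting transcendental equation.  Hence the semigroup
   generated by these flows is bounded, its orbit suprema give an extremal norm
   [nB] on the plane, and any homogeneous function that is nonincreasing along
   the flows is a multiple of [nB], because it is constant on the periodic orbit
   and this orbit meets every line through the origin.

   In dimension 4 = 2 + 2 the norm
     bar (a, b) = max over t in [0, pi] of e^-t nB (cos t a + sin t b)
   is nonincreasing along [X_0, X_1, X_2], and constant along the trajectory
   which follows [X_2] up to the maximizing [t] and then the periodic planar
   law.  So [bar] is a Barabanov norm of exponent 0; it is equal to [nB a]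
   whenever [nB b <= nB a], so that it is not strictly convex.  A Barabanov norm
   [N] satisfies [N (a, 0) = c nB a] by planar uniqueness; the trajectory above
   gives [N >= c bar], and the converse follows since the lower component of
   every trajectory comes arbitrarily close to 0. *)
Require Import Defs.
From HB Require Import structures.
From mathcomp Require Import all_boot all_order all_algebra.
From mathcomp Require Import all_classical all_reals all_analysis.
From mathcomp Require Import measurable_realfun mxtens complex.
From mathcomp Require Import ring lra.

Set Implicit Arguments.
Unset Strict Implicit.
Unset Printing Implicit Defensive.

Import Order.TTheory GRing.Theory Num.Theory.
Import numFieldNormedType.Exports.
Local Open Scope classical_set_scope.
Local Open Scope ring_scope.

(** The switching laws are merely measurable, so monotonicity along the explicit flows does not
    transfer directly to trajectories. What transfers is an infinitesimal bound: the upper Dini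
    derivative of a norm in the direction [A v] is convex in [A], so a bound checked on the three
    explicit flows holds on the whole hull, and a bound valid almost everywhere integrates because a
    norm is absolutely continuous along a trajectory. The formula for [bar] is a value function.
    [X_2] turns the lower component into the upper one at the price of a damping [e^-t], while a
    suitable law with values [X_0] and [X_1] preserves [nB] of the upper component forever and damps
    the lower one. So [bar] is the largest value of [nB] of the upper component that can be produced
    by [X_2] and then kept. Nothing is known about the trajectories that a given Barabanov norm
    singles out. Hence one half of uniqueness needs information on the lower component of every
    trajectory, which a second norm, decreasing at a definite rate, supplies. *)

(** * Monotonicity of absolutely continuous functions from Dini bounds *)

Section DiniMonotone.
Variable R : realType.
Implicit Types (f : R -> R) (a b t : R).

(** Continuity induction on the set of [t] up to which the inequality holds: the condition on the
    left closes this set at its supremum, the condition on the right pushes past it. [V] is a budget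
    that pays for increments of [f] at points where no derivative bound is available. *)
Lemma dini_le f (V : R -> R) a b (e : R) : a <= b ->
  (forall t, a < t <= b -> forall eps : R, 0 < eps ->
     exists2 d, 0 < d & forall s, a <= s -> t - d < s -> s <= t ->
       f t <= f s + eps) ->
  (forall s t, a <= s -> s <= t -> t <= b -> V s <= V t) ->
  (forall t, a <= t < b -> exists2 d, 0 < d & forall h, 0 < h < d ->
     t + h <= b -> f (t + h) <= f t + (V (t + h) - V t) + e * h) ->
  f b <= f a + (V b - V a) + e * (b - a).
Proof.
move=> ab fl Vm fr.
pose Q s := f s <= f a + (V s - V a) + e * (s - a).
pose S := [set t | a <= t <= b /\ forall s, a <= s <= t -> Q s].
have Qa : Q a by rewrite /Q !subrr mulr0 !addr0.
have Sa : S a.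
  split; first by rewrite lexx.
  by move=> s; rewrite -eq_le => /eqP <-.
have ubS : ubound S b by move=> t [/andP[]].
have hS : has_sup S by split; [exists a|exists b].
pose c := sup S.
have ac : a <= c by apply: sup_upper_bound.
have cb : c <= b by apply: ge_sup => //; exists a.
have ltc s : a <= s -> s < c -> Q s.
  move=> as_ sc; have [t [_ Qt] st] := sup_adherent (eqbRL (subr_gt0 _ _) sc) hS.
  by apply: Qt; rewrite as_ /=; rewrite subKr in st; exact: ltW.
have Qc : Q c.
  have [ac'|] := ltP a c; last first.
    by move=> ca; have -> : c = a by apply/eqP; rewrite eq_le ca.
  apply/ler_addgt0Pr => eps eps0.
  have [|d d0 fd] := fl c _ _ (divr_gt0 eps0 (ltr0n R 2)); first by rewrite ac'.
  have den0 : 0 < 2 * (`|e| + 1) by rewrite mulr_gt0 // ltr_wpDl.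
  (* Close enough to [c] for the condition on the left and for [e * (s - c)] to be at most
     [eps / 2], whatever the sign of [e]. *)
  pose s := Num.max a (Num.max (c - d / 2) (c - eps / (2 * (`|e| + 1)))).
  have e2 : 0 < eps / (2 * (`|e| + 1)) by rewrite divr_gt0.
  have sc : s < c by rewrite !gt_max ac' /= !gtrBl e2 divr_gt0.
  have as_ : a <= s by rewrite le_max lexx.
  have ds : c - d < s.
    by rewrite !lt_max ltrD2l ltrN2 ltr_pdivrMr // ltr_pMr // ltr1n orbT.
  have es : c - s <= eps / (2 * (`|e| + 1)).
    by rewrite lerBlDr -lerBlDl !le_max lexx !orbT.
  have := fd s as_ ds (ltW sc); have := ltc s as_ sc; rewrite /Q => h1 h2.
  have h3 := Vm s c as_ (ltW sc) cb.
  have h4 : e * (s - c) <= eps / 2.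
    apply: le_trans (ler_norm _) _; rewrite normrM (ler0_norm (x := s - c)).
      rewrite opprB; apply: (@le_trans _ _ ((`|e| + 1) * (eps / (2 * (`|e| + 1))))).
        by apply: ler_pM => //; [rewrite subr_ge0 ltW|rewrite lerDl].
      have h : `|e| + 1 != 0 by rewrite gt_eqF // ltr_wpDl.
      by rewrite le_eqVlt; apply/orP; left; apply/eqP; field.
    by rewrite subr_le0 ltW.
  lra.
have [cb'|bc] := ltP c b; last by have -> : b = c by apply/eqP; rewrite eq_le bc.
have [|d d0 fd] := fr c; first by rewrite ac.
pose h := Num.min (d / 2) (b - c).
have h0 : 0 < h by rewrite lt_min divr_gt0 //= subr_gt0.
have hd : h < d by rewrite gt_min ltr_pdivrMr // ltr_pMr // ltr1n.
have hb : c + h <= b by rewrite -lerBrDl ge_min lexx orbT.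
have Sh : S (c + h).
  split; first by rewrite hb (le_trans ac) // lerDl ltW.
  move=> s /andP[as_ sch].
  have [sc|cs] := ltP s c; first exact: ltc.
  have [->//|sc] := eqVneq s c.
  have cs' : c < s by rewrite lt_neqAle eq_sym sc.
  have := fd (s - c); rewrite subr_gt0 cs' /= ltrBlDl.
  rewrite [c + (s - c)]addrC subrK => /(_ (le_lt_trans sch _)).
  rewrite ltrD2l => /(_ hd) /(_ (le_trans sch hb)).
  move: Qc; rewrite /Q => Qc Qs; lra.
have := sup_upper_bound hS Sh; rewrite -/c; lra.
Qed.

Definition ac_real f a b := forall eps : R, 0 < eps -> exists2 delta : R, 0 < delta &
  forall (n : nat) (u v : 'I_n -> R),
    (forall i, a <= u i /\ u i <= v i /\ v i <= b) ->
    trivIset [set: 'I_n] (fun i => [set` `]u i, v i[]) ->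
    \sum_(i < n) (v i - u i) < delta ->
    \sum_(i < n) `|f (v i) - f (u i)| < eps.

(** Disjoint open intervals inside [U], listed from left to right: putting one more interval in
    front is then all it takes to compare variations beyond two points. *)
Fixpoint chain (U : set R) a b (l : seq (R * R)) : Prop :=
  if l is p :: l' then
    [/\ a <= p.1, p.1 <= p.2, `]p.1, p.2[ `<=` U & chain U p.2 b l']
  else a <= b.

Lemma chain_le U a b l : chain U a b l -> a <= b.
Proof.
elim: l a => //= p l IH a [h1 h2 _ /IH]; lra.
Qed.

Lemma chain_nth U a b l i : chain U a b l -> (i < size l)%N ->
  [/\ a <= (nth (0, 0) l i).1, (nth (0, 0) l i).1 <= (nth (0, 0) l i).2 &
      (nth (0, 0) l i).2 <= b].
Proof.
elim: l a i => //= p l IH a [|i] [h1 h2 _ c] /= si.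
  by split => //; exact: chain_le c.
by have [h3 h4 h5] := IH _ i c si; split => //; lra.
Qed.

Lemma chain_nth_lt U a b l i j : chain U a b l -> (i < j)%N -> (j < size l)%N ->
  (nth (0, 0) l i).2 <= (nth (0, 0) l j).1.
Proof.
elim: l a i j => //= p l IH a [|i] [|j] [h1 h2 _ c] //= ij sj.
  by have [] := chain_nth c sj.
exact: (IH _ i j c).
Qed.

Lemma chain_sub U a a' b l : a <= a' -> chain U a' b l -> chain U a b l.
Proof. by case: l => /= [|p l] aa'; [|case=> h1 h2 h3 h4; split => //]; lra. Qed.

Lemma chain_measure U a b l : open U -> chain U a b l ->
  ((\sum_(p <- l) (p.2 - p.1))%:E <=
     @lebesgue_measure R (U `&` `[a, +oo[%classic))%E.
Proof.
move=> oU; elim: l a => [|p l IH] a /=.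
  by move=> _; rewrite big_nil measure_ge0.
case=> h1 h2 pU /IH c; rewrite big_cons EFinD.
have mU : measurable (U : set (measurableTypeR R)) by exact: open_measurable.
have mI x : measurable (U `&` `[x, +oo[%classic : set (measurableTypeR R)).
  exact: measurableI.
have d0 : `]p.1, p.2[%classic `&` (U `&` `[p.2, +oo[%classic) = set0 :> set R.
  apply/seteqP; split => // y /= [] /[!in_itv]/= /andP[_ y2] [_].
  by rewrite andbT leNgt y2.
have -> : ((p.2 - p.1)%:E = @lebesgue_measure R `]p.1, p.2[%classic)%E.
  rewrite lebesgue_measure_itv /= lte_fin; case: ltP => //= h.
  by have -> : p.2 = p.1 by [apply/eqP; rewrite eq_le h]; rewrite subrr.
apply: (@le_trans _ _ (@lebesgue_measure R `]p.1, p.2[%classic +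
    @lebesgue_measure R (U `&` `[p.2, +oo[%classic))%E); first exact: leeD.
rewrite -measureU //; apply: le_measure; rewrite ?inE //.
  exact: measurableU.
move=> y [py|[Uy py]]; split=> //.
- exact: pU.
- by move: py; rewrite /= !in_itv /= => /andP[]; lra.
- by move: py; rewrite /= !in_itv /= !andbT; lra.
Qed.

Lemma ac_real_left f a b t : ac_real f a b -> a < t <= b ->
  forall eps : R, 0 < eps ->
     exists2 d, 0 < d & forall s, a <= s -> t - d < s -> s <= t ->
       f t <= f s + eps.
Proof.
move=> acf /andP[at_ tb] eps eps0; have [d d0 fd] := acf _ eps0.
exists d => // s as_ ds st.
have := fd 1%N (fun _ => s) (fun _ => t); rewrite !big_ord1 => h.
have {h} : `|f t - f s| < eps.
  apply: h => //; last by rewrite ltrBlDr addrC -ltrBlDr.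
  by move=> i j _ _ _; rewrite !ord1.
by rewrite ltr_norml => /andP[_]; rewrite ltrBlDl => /ltW.
Qed.

(* Cover [E] by an open [U] of small measure.  The variation [W t] of [f] on
   subintervals of [U] beyond [t] is small by absolute continuity, and its
   decrease pays for the increments of [f] inside [U]. *)
Lemma ac_dini_le f a b (E : set R) : a <= b -> ac_real f a b ->
  (@lebesgue_measure R).-negligible E ->
  (forall t, a <= t < b -> ~ E t -> forall eps : R, 0 < eps ->
    exists2 d, 0 < d & forall h, 0 < h < d -> f (t + h) <= f t + eps * h) ->
  f b <= f a.
Proof.
move=> ab acf [B [mB B0 EB]] fr.
apply/ler_addgt0Pr => eps eps0.
have e20 : 0 < eps / 2 by rewrite divr_gt0.
have [d d0 fd] := acf _ e20.
have Boo : (@lebesgue_measure R B < +oo)%E by rewrite [X in (X < _)%E]B0 ltry.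
have [U [oU BU mU]] := lebesgue_regularity_outer mB Boo d0.
have mUU : measurable (U : set (measurableTypeR R)) by exact: open_measurable.
have Ud : (@lebesgue_measure R U < d%:E)%E.
  have -> : U = (U `\` B) `|` B by rewrite setUC setDUK.
  apply: le_lt_trans (measureU2 _ _ _) _ => //; first exact: measurableD.
  by rewrite [X in (_ + X)%E]B0 adde0.
pose F (l : seq (R * R)) : R := \sum_(p <- l) `|f p.2 - f p.1|.
pose W t := sup [set F l | l in chain U t b].
have Fle t l : a <= t -> chain U t b l -> F l <= eps / 2.
  move=> at_ cl; rewrite /F (big_nth (0, 0)) big_mkord ltW //.
  apply: (fd (size l) (fun i => (nth (0, 0) l i).1)
    (fun i => (nth (0, 0) l i).2)).
  - by move=> i; have [] := chain_nth cl (ltn_ord i); split => //; lra.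
  - move=> i j _ _ [y /= []]; rewrite !in_itv /= => /andP[i1 i2] /andP[j1 j2].
    apply/val_inj; case: (ltngtP i j) => // ij.
      have := lt_le_trans i2 (chain_nth_lt cl ij (ltn_ord _)).
      by rewrite ltNge (ltW j1).
    have := lt_le_trans j2 (chain_nth_lt cl ij (ltn_ord _)).
    by rewrite ltNge (ltW i1).
  - have := chain_measure oU cl; rewrite (big_nth (0, 0)) big_mkord => h.
    rewrite -lte_fin; apply: le_lt_trans h _; apply: le_lt_trans Ud.
    by apply: le_measure; rewrite ?inE //; exact: measurableI.
have hW t : a <= t -> t <= b -> has_sup [set F l | l in chain U t b].
  move=> at_ tb; split; first by exists (F [::]), [::].
  by exists (eps / 2) => _ [l cl <-]; exact: Fle cl.
have Wcons s t : a <= s -> s <= t -> t <= b -> `]s, t[ `<=` U ->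
    `|f t - f s| + W t <= W s.
  move=> as_ st tb stU; rewrite -lerBrDl; apply: ge_sup.
    by have [] := hW t (le_trans as_ st) tb.
  move=> _ [l cl <-]; rewrite lerBrDl.
  apply: (sup_upper_bound (hW s as_ (le_trans st tb))).
  by exists ((s, t) :: l); [split|rewrite /F big_cons].
have Wm s t : a <= s -> s <= t -> t <= b -> - W s <= - W t.
  move=> as_ st tb; rewrite lerN2; apply: ge_sup.
    by have [] := hW t (le_trans as_ st) tb.
  move=> _ [l cl <-]; apply: (sup_upper_bound (hW s as_ (le_trans st tb))).
  by exists l => //; exact: chain_sub cl.
have Wa : W a <= eps / 2.
  by apply: ge_sup => [|_ [l cl <-]]; [have [] := hW a (lexx a) ab|exact: Fle cl].
have Wb : 0 <= W b.
  apply: (sup_upper_bound (hW b ab (lexx b))); exists [::] => //=.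
  by rewrite /F big_nil.
pose e := eps / 2 / (b - a + 1).
have e0 : 0 < e by rewrite divr_gt0 // ltr_wpDl // subr_ge0.
have := @dini_le f (fun t => - W t) a b e ab (fun t => ac_real_left acf) Wm.
have eab : e * (b - a) <= eps / 2.
  rewrite /e mulrAC ler_pdivrMr; last by rewrite ltr_wpDl // subr_ge0.
  by rewrite ler_pM2l //; lra.
move=> /(_ _); set G := (X in (X -> _) -> _); suff hG : G by move=> /(_ hG); lra.
move=> t /andP[at_ tb]; have [Ut|nUt] := pselect (U t).
  have [r /= r0 rU] := open_itvoo_subset oU Ut.
  exists (r / 2); first by rewrite divr_gt0.
  move=> h /andP[h0 hr] thb.
  have := Wcons t (t + h) at_; rewrite lerDl (ltW h0) => /(_ isT thb) => k.
  have {}k := k _; have : `|f (t + h) - f t| + W (t + h) <= W t.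
    apply: k => y /=; rewrite in_itv /= => /andP[y1 y2].
    apply: (rU (r / 2 )) => /=.
    - by rewrite sub0r normrN gtr0_norm ?divr_gt0 //; lra.
    - by rewrite divr_gt0.
    - by rewrite in_itv /=; lra.
  have := ler_norm (f (t + h) - f t); have := mulr_gt0 e0 h0; lra.
have [|//|r r0 hr] := fr t _ _ e e0; first by rewrite at_.
  by move=> /EB /BU.
exists r => // h hh thb; have := hr h hh.
have := Wm t (t + h) at_; case/andP: hh => h0 _.
by rewrite lerDl (ltW h0) => /(_ isT thb); lra.
Qed.

End DiniMonotone.

(** * Growth of a norm along trajectories with measurable laws *)

Section NormsAlongTrajectories.
Variable R : realType.

Lemma is_derive_lin (W : normedModType R) (x : R -> W) (t : R) (w : W) :
  is_derive t 1 x w -> forall eps : R, 0 < eps -> exists2 d : R, 0 < d &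
    forall h, `|h| < d -> `|x (t + h) - x t - h *: w| <= eps * `|h|.
Proof.
case=> dx dw eps eps0; have /eqaddoP /(_ _ eps0) := derivable_nbhs dx.
rewrite dw => /nbhs_ballP [d /= d0 dP].
exists d => // h hd; have := dP h.
rewrite /ball /= sub0r normrN => /(_ hd) /=.
by rewrite !fctE /= opprD addrA /GRing.scale /= mulr1 [h + t]addrC.
Qed.

Lemma coord_le_norm d (v : 'cV[R]_d) i : `|v i 0| <= `|v|.
Proof.
rewrite [in leRHS]/Num.Def.normr /= mx_normrE.
exact: (le_bigmax _ (fun ij => `|v ij.1 ij.2|) (i, 0)).
Qed.

Lemma enorm_ge0 d (v : 'cV[R]_d) : 0 <= enorm v.
Proof. exact: sqrtr_ge0. Qed.

Lemma coord_le_enorm d (v : 'cV[R]_d) i : `|v i 0| <= enorm v.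
Proof.
rewrite -sqrtr_sqr ler_wsqrtr // (bigD1 i) //= lerDl.
by apply: sumr_ge0 => j _; exact: sqr_ge0.
Qed.

Lemma norm_le_enorm d (v : 'cV[R]_d) : `|v| <= enorm v.
Proof.
rewrite [in leLHS]/Num.Def.normr /= mx_normrE.
apply: bigmax_le => [|[i j] _ /=]; first exact: enorm_ge0.
by rewrite ord1 coord_le_enorm.
Qed.

Lemma enorm_le_norm d (v : 'cV[R]_d) : enorm v <= d%:R * `|v|.
Proof.
rewrite -[leRHS]ger0_norm ?mulr_ge0 // -sqrtr_sqr ler_wsqrtr //.
apply: (@le_trans _ _ (\sum_(i < d) `|v| ^+ 2)).
  apply: ler_sum => i _; rewrite -real_normK ?num_real //.
  by rewrite lerXn2r ?nnegrE // coord_le_norm.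
rewrite sumr_const card_ord -[leLHS]mulr_natl exprMn ler_wpM2r ?sqr_ge0 //.
by rewrite -natrX ler_nat; case: d {v} => // d; rewrite leq_pmulr.
Qed.

Section IsNorm.
Variables (d : nat) (N : 'cV[R]_d -> R).
Hypothesis nN : is_norm N.

Lemma is_norm_ge0 v : 0 <= N v. Proof. by case: nN. Qed.

Lemma is_norm_eq0 v : N v = 0 -> v = 0. Proof. by case: nN => _ h _ _; exact: h. Qed.

Lemma is_normZ a v : N (a *: v) = `|a| * N v. Proof. by case: nN. Qed.

Lemma is_normD v w : N (v + w) <= N v + N w. Proof. by case: nN. Qed.

Lemma is_norm0 : N 0 = 0.
Proof. by rewrite -(scale0r 0) is_normZ normr0 mul0r. Qed.

Lemma is_normN v : N (- v) = N v.
Proof. by rewrite -scaleN1r is_normZ normrN1 mul1r. Qed.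

Lemma is_norm_gt0 v : v != 0 -> 0 < N v.
Proof.
move=> v0; rewrite lt_def is_norm_ge0 andbT.
by apply: contra_neq v0; exact: is_norm_eq0.
Qed.

Lemma is_norm_distB v w : `|N v - N w| <= N (v - w).
Proof.
rewrite ler_norml; have := is_normD (v - w) w; have := is_normD (w - v) v.
by rewrite !subrK -(opprB v w) is_normN; lra.
Qed.

Lemma is_norm_sum (I : finType) (F : I -> 'cV[R]_d) :
  N (\sum_i F i) <= \sum_i N (F i).
Proof.
elim/big_ind2 : _ => // [|x1 x2 y1 y2 h1 h2]; first by rewrite is_norm0.
by rewrite (le_trans (is_normD _ _)) // lerD.
Qed.

Lemma is_norm_le_norm : exists2 C : R, 0 < C & forall v, N v <= C * `|v|.
Proof.
exists (1 + \sum_(i < d) N (delta_mx i 0)).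
  by rewrite ltr_wpDr //; apply: sumr_ge0 => i _; exact: is_norm_ge0.
move=> v; rewrite [in leLHS](matrix_sum_delta v).
apply: le_trans (is_norm_sum _) _.
rewrite mulrDl mul1r ler_wpDl // mulr_suml; apply: ler_sum => i _.
rewrite big_ord1 is_normZ mulrC ler_wpM2l ?is_norm_ge0 //.
exact: coord_le_norm.
Qed.

(* The upper right Dini derivative of [N] at [v] in the direction [A *m v] is
   at most [c]. *)
Definition fwd_rate (A : 'M[R]_d) (v : 'cV[R]_d) (c : R) :=
  forall eps : R, 0 < eps -> exists2 r : R, 0 < r &
    forall h : R, 0 < h < r -> N (v + h *: (A *m v)) <= N v + h * c + eps * h.

Lemma fwd_rate_derive A v c (x : R -> 'cV[R]_d) t : x t = v ->
  is_derive t 1 x (A *m v) -> fwd_rate A v c ->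
  forall eps : R, 0 < eps -> exists2 r : R, 0 < r &
    forall h : R, 0 < h < r -> N (x (t + h)) <= N v + h * c + eps * h.
Proof.
move=> xt dx fr eps eps0; have [C C0 NC] := is_norm_le_norm.
have e2 : 0 < eps / 2 by rewrite divr_gt0.
have [r1 r10 fr1] := fr _ e2.
have [r2 r20 fr2] := is_derive_lin dx (divr_gt0 e2 C0).
exists (Num.min r1 r2); first by rewrite lt_min r10.
move=> h /andP[h0]; rewrite lt_min => /andP[hr1 hr2].
have := fr1 h; rewrite h0 hr1 => /(_ isT) k1.
have := fr2 h; rewrite gtr0_norm // => /(_ hr2) k2.
have -> : x (t + h) = (v + h *: (A *m v)) + (x (t + h) - x t - h *: (A *m v)).
  by rewrite xt [RHS]addrC -addrA [- (h *: _) + _]addrC addrK subrK.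
apply: le_trans (is_normD _ _) _.
have : N (x (t + h) - x t - h *: (A *m v)) <= eps / 2 * h.
  apply: le_trans (NC _) _; rewrite mulrC -ler_pdivlMr //.
  by rewrite mulrAC.
lra.
Qed.

(** Since [v + h A v] differs from the flow by [o(h)], a bound along an explicit flow becomes an
    infinitesimal one, which no longer refers to that flow. *)
Lemma fwd_rate_flow A v c (x : R -> 'cV[R]_d) : x 0 = v ->
  is_derive (0 : R) 1 x (A *m v) ->
  (exists2 r : R, 0 < r & forall h : R, 0 < h < r -> N (x h) <= N v + h * c) ->
  fwd_rate A v c.
Proof.
move=> x0 dx [r r0 xr] eps eps0; have [C C0 NC] := is_norm_le_norm.
have [r2 r20 fr2] := is_derive_lin dx (divr_gt0 eps0 C0).
exists (Num.min r r2); first by rewrite lt_min r0.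
move=> h /andP[h0]; rewrite lt_min => /andP[hr1 hr2].
have := fr2 h; rewrite gtr0_norm // add0r => /(_ hr2) k2.
have -> : v + h *: (A *m v) = x h - (x h - x 0 - h *: (A *m v)).
  by rewrite x0 -[x h - v - _]addrA -opprD opprB [RHS]addrC subrK.
apply: le_trans (is_normD _ _) _; rewrite is_normN.
have : N (x h - x 0 - h *: (A *m v)) <= eps * h.
  apply: le_trans (NC _) _; rewrite mulrC -ler_pdivlMr //.
  by rewrite mulrAC.
have := xr h; rewrite h0 hr1 => /(_ isT); lra.
Qed.

(** The Euler step of a convex combination is the convex combination of the Euler steps. This is how
    the convex hull is handled without approximating its trajectories by switching ones. *)
Lemma fwd_rate_conv (A B : 'M[R]_d) v c (s : R) : 0 <= s <= 1 ->
  fwd_rate A v c -> fwd_rate B v c -> fwd_rate (s *: A + (1 - s) *: B) v c.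
Proof.
move=> /andP[s0 s1] fA fB eps eps0.
have [r1 r10 fr1] := fA _ eps0; have [r2 r20 fr2] := fB _ eps0.
exists (Num.min r1 r2); first by rewrite lt_min r10.
move=> h /andP[h0]; rewrite lt_min => /andP[hr1 hr2].
have := fr1 h; rewrite h0 hr1 => /(_ isT) k1.
have := fr2 h; rewrite h0 hr2 => /(_ isT) k2.
have -> : v + h *: ((s *: A + (1 - s) *: B) *m v) =
    s *: (v + h *: (A *m v)) + (1 - s) *: (v + h *: (B *m v)).
  rewrite mulmxDl -!scalemxAl !scalerDr !scalerA addrACA -scalerDl.
  by rewrite [s + _]addrC subrK scale1r [h * s]mulrC [h * (1 - s)]mulrC.
apply: le_trans (is_normD _ _) _; rewrite !is_normZ !ger0_norm ?subr_ge0 //.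
have s1' : 0 <= 1 - s by rewrite subr_ge0.
have := ler_wpM2l s0 k1; have := ler_wpM2l s1' k2; nra.
Qed.

Lemma norm_along_ac (x : R -> 'cV[R]_d) (b : R) : abs_continuous_on 0 b x ->
  ac_real (N \o x) 0 b.
Proof.
move=> acx eps eps0; have [C C0 NC] := is_norm_le_norm.
have [r r0 rP] := acx _ (divr_gt0 eps0 C0); exists r => // n u v uv tI suv.
have := rP n u v uv tI suv; rewrite ltr_pdivlMr // mulr_suml.
apply: le_lt_trans; apply: ler_sum => i _ /=.
apply: le_trans (is_norm_distB _ _) _; apply: le_trans (NC _) _.
by rewrite mulrC ler_wpM2r ?(ltW C0) // norm_le_enorm.
Qed.

Lemma ac_real_bounded (f : R -> R) (b : R) : 0 <= b -> ac_real f 0 b ->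
  exists2 B : R, 0 <= B & forall t, 0 <= t <= b -> `|f t| <= B.
Proof.
move=> b0 acf.
have cf : {within `[0, b], continuous (fun t => `|f t|)}.
  apply/subspace_continuousP => t /=; rewrite in_itv /= => /andP[t0 tb].
  apply/cvgrPdist_le => e e0; have [r r0 rP] := acf _ e0.
  rewrite near_withinE; near=> s; rewrite /= in_itv /= => /andP[s0 sb].
  apply: le_trans (ler_dist_dist _ _) _.
  have st : `|t - s| < r by near: s; exact: cvgr_dist_lt.
  have [ts|st'] := leP t s.
    have := rP 1%N (fun _ => t) (fun _ => s); rewrite !big_ord1 distrC => h.
    apply/ltW/h => [//|i j _ _ _|]; first by rewrite !ord1.
    by apply: le_lt_trans st; rewrite distrC ler_norm.
  have := rP 1%N (fun _ => s) (fun _ => t); rewrite !big_ord1 => h.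
  apply/ltW/h => [_|i j _ _ _|]; first by split=> //; rewrite ltW.
    by rewrite !ord1.
  by apply: le_lt_trans st; rewrite ler_norm.
have [c _ cP] := EVT_max b0 cf.
exists `|f c| => // t tb; apply: cP; by rewrite in_itv.
Unshelve. all: by end_near. Qed.

(** The exponential factor is Lipschitz and [f] is bounded on the interval, so an increment of the
    product is at most an increment of [f] plus a Lipschitz term with constant [L]. *)
Lemma ac_expM (f : R -> R) (b l k : R) : 0 <= b -> 0 <= l -> 0 <= k ->
  ac_real f 0 b -> ac_real (fun t => expR (- (t * l)) * (f t + k * t)) 0 b.
Proof.
move=> b0 l0 k0 acf; have [B B0 fB] := ac_real_bounded b0 acf.
pose L := l * (B + k * b) + k.
have L0 : 0 <= L by rewrite addr_ge0 // mulr_ge0 // addr_ge0 // mulr_ge0.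
have key u v : 0 <= u -> u <= v -> v <= b ->
    `|expR (- (v * l)) * (f v + k * v) - expR (- (u * l)) * (f u + k * u)| <=
    `|f v - f u| + L * (v - u).
  move=> u0 uv vb; set p := expR _; set q := expR _.
  have p0 : 0 < p := expR_gt0 _.
  have p1 : p <= 1.
    by rewrite -expR0 ler_expR oppr_le0 mulr_ge0 // (le_trans u0).
  have q1 : q <= 1 by rewrite -expR0 ler_expR oppr_le0 mulr_ge0.
  have q0 : 0 < q := expR_gt0 _.
  have pq : p = q * expR (- ((v - u) * l)).
    by rewrite -expRD; congr expR; ring.
  have vul : 0 <= (v - u) * l by rewrite mulr_ge0 // subr_ge0.
  have e1 : expR (- ((v - u) * l)) <= 1 by rewrite -expR0 ler_expR oppr_le0.
  have e2 := expR_ge1Dx (- ((v - u) * l)).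
  have -> : p * (f v + k * v) - q * (f u + k * u) =
      p * ((f v - f u) + k * (v - u)) - (q - p) * (f u + k * u) by ring.
  apply: le_trans (ler_normB _ _) _; rewrite !normrM (gtr0_norm p0).
  have h1 : p * `|f v - f u + k * (v - u)| <= `|f v - f u| + k * (v - u).
    apply: (@le_trans _ _ `|f v - f u + k * (v - u)|).
      by rewrite ler_piMl.
    apply: le_trans (ler_normD _ _) _; rewrite lerD2l ger0_norm //.
    by rewrite mulr_ge0 // subr_ge0.
  have h2 : `|q - p| <= l * (v - u).
    rewrite pq ger0_norm; last by rewrite subr_ge0 ler_piMr // ltW.
    rewrite -[X in X - _]mulr1 -mulrBr.
    apply: (@le_trans _ _ (1 - expR (- ((v - u) * l)))).
      by rewrite ler_piMl // subr_ge0.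
    lra.
  have h3 : `|f u + k * u| <= B + k * b.
    apply: le_trans (ler_normD _ _) _; apply: lerD.
      by apply: fB; rewrite u0 (le_trans uv).
    by rewrite ger0_norm ?mulr_ge0 // ler_wpM2l // (le_trans uv).
  have := ler_pM (normr_ge0 _) (normr_ge0 _) h2 h3.
  rewrite /L; lra.
move=> eps eps0; have e2 : 0 < eps / 2 by rewrite divr_gt0.
have [r r0 rP] := acf _ e2.
have L1 : 0 < L + 1 by rewrite ltr_wpDl.
exists (Num.min r (eps / 2 / (L + 1))); first by rewrite lt_min r0 divr_gt0.
move=> n u v uv tI; rewrite lt_min => /andP[sr se].
apply: (@le_lt_trans _ _ (\sum_(i < n) `|f (v i) - f (u i)| +
    L * \sum_(i < n) (v i - u i))).
  rewrite mulr_sumr -big_split; apply: ler_sum => i _.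
  by have [h1 [h2 h3]] := uv i; exact: key.
have := rP n u v uv tI sr; move: se; rewrite ltr_pdivlMr //.
have : 0 <= \sum_(i < n) (v i - u i).
  by apply: sumr_ge0 => i _; have [_ [h _]] := uv i; rewrite subr_ge0.
lra.
Qed.

(** Formally the derivative is at most [e^(-t l) (l N - k + k - l (N + k t))], which is at most 0.
    Taking [k = 0] bounds the exponential growth of the planar pair; taking [l = 0] gives monotone
    norms and norms with linear decrease. *)
Lemma norm_along_trajectory (AA : set 'M[R]_d) x (l k a b : R) :
  trajectory AA x -> 0 <= l -> 0 <= k -> 0 <= a -> a <= b ->
  (forall t A, a <= t -> AA A -> fwd_rate A (x t) (l * N (x t) - k)) ->
  expR (- (b * l)) * (N (x b) + k * b) <= expR (- (a * l)) * (N (x a) + k * a).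
Proof.
move=> [acx [A [AAA _] dx]] l0 k0 a0 ab fr.
pose f t := expR (- (t * l)) * (N (x t) + k * t).
have b0 := le_trans a0 ab.
have acf : ac_real f a b.
  have h : ac_real f 0 b by apply: ac_expM => //; exact/norm_along_ac/acx.
  move=> e e0; have [r r0 rP] := h e e0; exists r => // n u v uv.
  by apply: rP => i; have [h1 h2] := uv i; split => //; exact: le_trans h1.
apply: (ac_dini_le ab acf dx) => t /andP[at_ tb] /contrapT dxt eps eps0.
have t0 := le_trans a0 at_; have {}dxt := dxt t0.
have [r r0 rP] := fwd_rate_derive erefl dxt (fr t _ at_ (AAA t t0)) eps0.
exists r => // h hr; have h0 : 0 < h by case/andP: hr.
have Nk := rP h hr; rewrite /f.
set p := expR _; set q := expR _.
have p0 : 0 < p := expR_gt0 _.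
have q1 : q <= 1 by rewrite -expR0 ler_expR oppr_le0 mulr_ge0.
have q0 : 0 < q := expR_gt0 _.
have lh : 0 <= l * h by rewrite mulr_ge0 // ltW.
have qp : p * expR (l * h) = q.
  by rewrite /p /q -expRD; congr expR; ring.
have k1 : p * (1 + l * h) <= q.
  by rewrite -qp ler_wpM2l ?expR_ge1Dx // ltW.
have pq : p <= q.
  by rewrite -qp ler_peMr ?(ltW p0) // -expR0 ler_expR.
have N0 := is_norm_ge0 (x t).
have kt : 0 <= k * t by rewrite mulr_ge0.
apply: (@le_trans _ _ (p * ((1 + l * h) * N (x t) + k * t + eps * h))).
  by rewrite ler_wpM2l ?(ltW p0) //; lra.
have := ler_wpM2r N0 k1; have := ler_wpM2r kt pq.
have eh : 0 <= eps * h by rewrite mulr_ge0 // ltW.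
have := ler_wpM2r eh (le_trans pq q1); lra.
Qed.

Lemma norm_along_trajectory0 (AA : set 'M[R]_d) x (k a b : R) :
  trajectory AA x -> 0 <= k -> 0 <= a -> a <= b ->
  (forall t A, a <= t -> AA A -> fwd_rate A (x t) (- k)) ->
  N (x b) + k * b <= N (x a) + k * a.
Proof.
move=> tx k0 a0 ab fr.
have := norm_along_trajectory tx (lexx 0) k0 a0 ab.
rewrite !mulr0 oppr0 expR0 !mul1r; apply=> t A at_ AAA.
by rewrite mul0r sub0r; exact: fr.
Qed.

End IsNorm.
End NormsAlongTrajectories.

(** * Flows of constant matrices and their regularity *)

Section Flows.
Variables (R : realType) (d : nat).
Implicit Types (x y : R -> 'cV[R]_d) (A : 'M[R]_d) (E : R -> 'M[R]_d).
Implicit Types (t a b c : R) (v w : 'cV[R]_d).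

Lemma is_derive_coord x t w i :
  is_derive t 1 x w -> is_derive t 1 (fun s => x s i 0) (w i 0).
Proof.
case=> dx <-; have dxi := (derivable_mxP x t 1).1 dx i 0.
by apply: DeriveDef => //; rewrite (derive_mx dx) mxE.
Qed.

Lemma is_derive_cV x t w :
  (forall i, is_derive t 1 (fun s => x s i 0) (w i 0)) -> is_derive t 1 x w.
Proof.
move=> dx; have dX : derivable x t 1.
  by apply/derivable_mxP => i j; rewrite (ord1 j); case: (dx i).
apply: DeriveDef => //; rewrite (derive_mx dX); apply/colP => i.
by rewrite mxE; case: (dx i).
Qed.

(** Stands in for the matrix exponential: all flows below are available in closed form through
    [cos], [sin] and [expR]. *)
Definition flow A E :=
  E 0 = 1%:M /\ forall (t : R) v, is_derive t 1 (fun s => E s *m v) (A *m (E t *m v)).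

Definition lip x (a b : R) := exists2 L : R, 0 <= L &
  forall u v : R, a <= u -> u <= v -> v <= b -> `|x v - x u| <= L * (v - u).

Lemma lip_glue x a b c : lip x a b -> lip x b c -> lip x a c.
Proof.
move=> [L L0 h1] [M M0 h2]; exists (Num.max L M); first by rewrite le_max L0.
move=> u v au uv vc.
have LM : L <= Num.max L M by rewrite le_max lexx.
have ML : M <= Num.max L M by rewrite le_max lexx orbT.
have uv0 : 0 <= v - u by rewrite subr_ge0.
have [vb|/ltW bv] := leP v b.
  by apply: le_trans (h1 u v au uv vb) _; rewrite ler_wpM2r.
have [bu|/ltW ub] := leP b u.
  by apply: le_trans (h2 u v bu uv vc) _; rewrite ler_wpM2r.
have -> : x v - x u = (x v - x b) + (x b - x u) by rewrite addrA subrK.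
apply: le_trans (ler_normD _ _) _.
have := h1 u b au ub (lexx _); have := h2 b v (lexx _) bv vc.
have vb0 : 0 <= v - b by rewrite subr_ge0.
have bu0 : 0 <= b - u by rewrite subr_ge0.
have := ler_wpM2r vb0 ML; have := ler_wpM2r bu0 LM; lra.
Qed.

Lemma lip_eq x y a b : (forall t, a <= t <= b -> x t = y t) -> lip y a b ->
  lip x a b.
Proof.
move=> xy [L L0 h]; exists L => // u v au uv vb.
have hu : a <= u <= b by rewrite au (le_trans uv).
have hv : a <= v <= b by rewrite (le_trans au uv).
by rewrite (xy _ hu) (xy _ hv); exact: h.
Qed.

Lemma flow_coord_continuous A E v i : flow A E ->
  continuous (fun s => (E s *m v) i 0).
Proof.
move=> [_ dE] t; apply/differentiable_continuous/derivable1_diffP.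
by case: (is_derive_coord i (dE t v)).
Qed.

(** The mean value theorem in each coordinate, with the derivative [A z] bounded because [z] is
    continuous on a compact interval. *)
Lemma flow_lip A E v c a b : flow A E -> a <= b ->
  lip (fun t => E (t - c) *m v) a b.
Proof.
move=> fE ab; pose z s := E s *m v.
have bz i : exists2 B : R, 0 <= B & forall s, a - c <= s <= b - c -> `|z s i 0| <= B.
  have zc : {within `[a - c, b - c], continuous (fun s => `|z s i 0|)}.
    apply: continuous_subspaceT => s; apply: continuous_comp.
      exact: flow_coord_continuous fE s.
    exact: norm_continuous.
  have [|s _ sP] := EVT_max _ zc; first by rewrite lerD2r.
  by exists `|z s i 0| => // s' s'P; apply: sP; rewrite in_itv.
pose B i := s2val (cid2 (bz i)).
have B0 i : 0 <= B i by rewrite /B; case: cid2.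
have BP i : forall s, a - c <= s <= b - c -> `|z s i 0| <= B i.
  by rewrite /B; case: cid2.
pose L := \sum_i \sum_j `|A i j| * B j.
have L0 : 0 <= L by do 2!apply: sumr_ge0 => ? _; rewrite mulr_ge0.
exists L => // u w au uw wb.
rewrite [leLHS]/Num.Def.normr /= mx_normrE; apply: bigmax_le => [|[i j] _ /=].
  by rewrite mulr_ge0 // subr_ge0.
rewrite ord1 mxE [X in _ + X]mxE.
have uwc : u - c <= w - c by rewrite lerD2r.
have [||s sP ->] := @MVT_segment R (fun s => z s i 0)
  (fun s => (A *m z s) i 0) _ _ uwc.
- by move=> s _; apply: is_derive_coord; case: fE => _; exact.
- by apply: continuous_subspaceT => s; exact: flow_coord_continuous fE s.
have -> : w - c - (u - c) = w - u by ring.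
rewrite normrM (ger0_norm (x := w - u)) ?subr_ge0 // ler_wpM2r ?subr_ge0 //.
rewrite mxE; apply: le_trans (ler_norm_sum _ _ _) _.
apply: (@le_trans _ _ (\sum_j `|A i j| * B j)).
  apply: ler_sum => k _; rewrite normrM ler_wpM2l // BP //.
  by move: sP; rewrite in_itv /= => /andP[s1 s2]; apply/andP; split; lra.
rewrite /L [leRHS](bigD1 i) //= lerDl.
by do 2!apply: sumr_ge0 => ? _; rewrite mulr_ge0.
Qed.

Lemma flow_shift_derive A E v c t : flow A E ->
  is_derive t 1 (fun s => E (s - c) *m v) (A *m (E (t - c) *m v)).
Proof.
move=> [_ dE]; apply: is_derive_cV => i.
have h := is_derive_coord i (dE (t - c) v).
have hs : is_derive t 1 (fun s : R => s - c) (1 : R).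
  exact: (@is_derive_shift R t 1 (- c)).
rewrite -[X in is_derive _ _ _ X]mulr1.
exact: (@is_derive1_comp R (fun s => (E s *m v) i 0) (fun s => s - c) t _ 1 h hs).
Qed.

Lemma lip_ac x b : lip x 0 b -> abs_continuous_on 0 b x.
Proof.
move=> [L L0 h] eps eps0; pose K := d%:R * L + 1.
have K0 : 0 < K by rewrite ltr_wpDl // mulr_ge0.
exists (eps / K); first by rewrite divr_gt0.
move=> n u v uv _; rewrite ltr_pdivlMr // mulrC mulr_sumr.
apply: le_lt_trans; apply: ler_sum => i _; have [h1 [h2 h3]] := uv i.
apply: le_trans (enorm_le_norm _) _.
apply: (@le_trans _ _ (d%:R * (L * (v i - u i)))).
  by rewrite ler_wpM2l // h.
by rewrite mulrA ler_wpM2r ?subr_ge0 // lerDl.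
Qed.

End Flows.

(** * Trajectories of piecewise constant switching laws *)

Section StepTrajectories.
Variables (R : realType) (d : nat) (AA : set 'M[R]_d).
Variables (A : nat -> 'M[R]_d) (E : nat -> R -> 'M[R]_d) (b : nat -> R).
Variable (u : 'cV[R]_d).
Hypothesis AAA : forall k, AA (A k).
Hypothesis fE : forall k, flow (A k) (E k).
Hypothesis b0 : b 0%N = 0.
Hypothesis bS : forall k, b k <= b k.+1.
Hypothesis binfty : forall t, exists k, t < b k.+1.

(** [bS] permits stages of length zero, which do occur in [optimal_trajectory]; the least index with
    [t < b k.+1] skips them. *)
Definition step_idx t := ex_minn (binfty t).

Fixpoint step_node k : 'cV[R]_d :=
  if k is k'.+1 then E k' (b k - b k') *m step_node k' else u.

Definition step_traj t := E (step_idx t) (t - b (step_idx t)) *m step_node (step_idx t).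

Lemma step_homo : {homo b : i j / (i <= j)%N >-> i <= j}.
Proof. exact: (homo_leq lexx le_trans). Qed.

Lemma step_idxE k t : b k <= t -> t < b k.+1 -> step_idx t = k.
Proof.
move=> bt tb; rewrite /step_idx; case: ex_minnP => m tm mmin.
apply/eqP; rewrite eqn_leq mmin //= leqNgt; apply/negP => mk.
by have := step_homo mk; rewrite leNgt (le_lt_trans bt tm).
Qed.

Lemma step_idx_ltP t : 0 <= t -> b (step_idx t) <= t /\ t < b (step_idx t).+1.
Proof.
move=> t0; rewrite /step_idx; case: ex_minnP => -[|m] tm mmin; split => //.
  by rewrite b0.
by rewrite leNgt; apply/negP => /mmin; rewrite ltnn.
Qed.

Lemma step_node_eq k m : b k = b (k + m)%N -> step_node (k + m) = step_node k.
Proof.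
elim: m => [|m IH] bkm; first by rewrite addn0.
have h1 : b k <= b (k + m)%N by apply: step_homo; rewrite leq_addr.
have h2 := bS (k + m); rewrite -addnS -bkm in h2.
have e : b (k + m)%N = b k by apply/eqP; rewrite eq_le h1 h2.
rewrite addnS /= -addnS -bkm e subrr IH //.
by have [-> _] := fE (k + m); rewrite mul1mx.
Qed.

(** The right endpoint is included so that consecutive pieces can be glued. There the index has
    already moved on, possibly past several stages of length zero, along which the node is
    constant. *)
Lemma step_trajE k t : b k <= t -> t <= b k.+1 ->
  step_traj t = E k (t - b k) *m step_node k.
Proof.
move=> bt; rewrite le_eqVlt => /orP[/eqP tE|tb]; last first.
  by rewrite /step_traj (step_idxE bt tb).
have t0 : 0 <= t by rewrite -b0; apply: le_trans bt; exact: step_homo.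
have [i1 i2] := step_idx_ltP t0; set m := step_idx t in i1 i2.
have km : (k.+1 <= m)%N.
  rewrite leqNgt; apply/negP => /step_homo.
  by rewrite leNgt -tE i2.
have bm : b k.+1 = b (k.+1 + (m - k.+1))%N.
  rewrite subnKC //; apply/eqP; rewrite eq_le step_homo //=.
  by rewrite -tE.
rewrite /step_traj -/m -(subnKC km) (step_node_eq bm) -bm tE subrr.
by have [-> _] := fE (k.+1 + (m - k.+1)); rewrite mul1mx.
Qed.

Lemma step_traj0 : step_traj 0 = u.
Proof.
rewrite (@step_trajE 0%N) ?b0 ?subrr //=; last by rewrite -b0.
by have [-> _] := fE 0%N; rewrite mul1mx.
Qed.

Lemma step_traj_lip k : lip step_traj 0 (b k).
Proof.
elim: k => [|k IH].
  exists 0 => // v w v0 vw wb; have -> : w = v.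
    by apply/eqP; rewrite eq_le vw (le_trans wb) // b0.
  by rewrite !subrr normr0 mulr0.
apply: (lip_glue IH); apply: lip_eq (flow_lip (step_node k) (b k) (fE k) (bS k)).
by move=> t /andP[]; exact: step_trajE.
Qed.

Lemma step_switching_law : switching_law AA (fun t => A (step_idx t)).
Proof.
split=> [t _|i j _ Y mY]; first exact: AAA.
have -> : [set` `[0, +oo[] `&` ((fun t => A (step_idx t) i j) @^-1` Y) =
    \bigcup_(k in [set k | Y (A k i j)]) [set` `[b k, b k.+1[] :> set R.
  apply/seteqP; split => [t /= []|t [k /= Yk]].
    rewrite in_itv /= andbT => t0 Yt; exists (step_idx t) => //=.
    by have [h1 h2] := step_idx_ltP t0; rewrite in_itv /= h1.
  rewrite in_itv /= => /andP[h1 h2]; rewrite in_itv /= andbT.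
  split; last by rewrite (step_idxE h1 h2).
  by apply: le_trans h1; rewrite -b0; exact: step_homo.
apply: bigcup_measurable => k _; apply: sub_caratheodory.
exact: (@measurable_itv R).
Qed.

Lemma step_trajectory : trajectory AA step_traj.
Proof.
split=> [T T0|].
  have [k /ltW Tk] := binfty T; apply: lip_ac; have [L L0 h] := step_traj_lip k.+1.
  by exists L => // v w v0 vw wT; apply: h => //; exact: le_trans Tk.
exists (fun t => A (step_idx t)); first exact: step_switching_law.
exists (range b); split.
- by rewrite -[range b]bigcup_imset1; apply: bigcup_measurable => k _.
- apply: countable_lebesgue_measure0.
  exact: card_le_trans (card_image_le b setT) (countableP _).
move=> t /= /not_implyP[t0 ndx]; apply: contrapT => tb; apply: ndx.
have [h1 h2] := step_idx_ltP t0; set k := step_idx t in h1 h2 *.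
have {}h1 : b k < t.
  by rewrite lt_neqAle h1 andbT; apply/eqP => h; apply: tb; exists k.
rewrite (@step_trajE k) ?(ltW h1) ?(ltW h2) //.
apply: near_eq_is_derive (flow_shift_derive (step_node k) (b k) t (fE k)).
near=> s; rewrite (@step_trajE k) //.
  by apply/ltW; near: s; exact: lt_nbhsr.
by apply/ltW; near: s; exact: lt_nbhsl.
Unshelve. all: by end_near. Qed.

End StepTrajectories.

(** * Computing Lyapunov exponents; damped rotations *)

Section LyapunovExponent.
Variable R : realType.

Lemma enorm_gt0 d (v : 'cV[R]_d) : v != 0 -> 0 < enorm v.
Proof. by move=> v0; apply: lt_le_trans (norm_le_enorm v); rewrite normr_gt0. Qed.

(** The two bounds place [max_growth_rate] within [K / t] of [l], where [K] absorbs the logarithms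
    of the constants; the existence of the limit is part of the conclusion. *)
Lemma lyapunov_exponentE d (AA : set 'M[R]_d) (l C c : R) (x : R -> 'cV[R]_d) :
  0 <= l -> 0 < C ->
  (forall y, trajectory AA y -> forall t : R, 0 <= t ->
     enorm (y t) <= C * expR (l * t) * enorm (y 0)) ->
  trajectory AA x -> x 0 != 0 -> 0 < c ->
  (forall t : R, 0 <= t -> c * expR (l * t) <= enorm (x t)) ->
  lyapunov_exponent AA = l.
Proof.
move=> l0 C0 ub tx x0 c0 lb.
pose K := ln (C + 1) + `|ln (c / enorm (x 0))|.
have C1 : 0 <= ln (C + 1) by rewrite ln_ge0 // lerDr ltW.
have K0 : 0 <= K by rewrite addr_ge0.
have key (t : R) : 0 < t -> `|l - max_growth_rate AA t| <= K / t.
  move=> t0; have tn0 : t != 0 by rewrite gt_eqF.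
  have ubt : forall r : R,
    [set t^-1 * ln (enorm (y t) / enorm (y 0)) |
         y in [set y | trajectory AA y /\ y 0 != 0]] r -> r <= l + K / t.
    move=> _ [y [ty y0] <-]; have ey := enorm_gt0 y0.
    have -> : l + K / t = t^-1 * (K + l * t) by field.
    rewrite ler_pM2l ?invr_gt0 //.
    (* A vanishing [y t] contributes [ln 0 = 0] to the supremum by the default value of [ln]; this
       is harmless because [K] and [l] are nonnegative. *)
    have [->|r0] := eqVneq (enorm (y t)) 0.
      by rewrite mul0r ln0 // addr_ge0 // mulr_ge0 // ltW.
    have r0' : 0 < enorm (y t) by rewrite lt_def r0 enorm_ge0.
    apply: (@le_trans _ _ (ln ((C + 1) * expR (l * t)))).
      rewrite ler_ln ?posrE ?divr_gt0 ?mulr_gt0 ?expR_gt0 ?addr_gt0 //.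
      rewrite ler_pdivrMr //; apply: le_trans (ub y ty t (ltW t0)) _.
      by rewrite ler_wpM2r ?(ltW ey) // ler_wpM2r ?expR_ge0 // lerDl.
    rewrite lnM ?posrE ?expR_gt0 ?addr_gt0 // expRK lerD2r lerDl.
    exact: normr_ge0.
  have le1 : max_growth_rate AA t <= l + K / t.
    by apply: ge_sup => //; exists (t^-1 * ln (enorm (x t) / enorm (x 0))), x.
  have le2 : l - K / t <= max_growth_rate AA t.
    apply: (@le_trans _ _ (t^-1 * ln (enorm (x t) / enorm (x 0)))); last first.
      apply: sup_upper_bound; last by exists x.
      split; first by exists (t^-1 * ln (enorm (x t) / enorm (x 0))), x.
      by exists (l + K / t).
    have -> : l - K / t = t^-1 * (l * t - K) by field.
    rewrite ler_pM2l ?invr_gt0 //; have ex := enorm_gt0 x0.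
    apply: (@le_trans _ _ (ln (c / enorm (x 0) * expR (l * t)))).
      rewrite lnM ?posrE ?expR_gt0 ?divr_gt0 // expRK /K.
      by have := ler_norm (- ln (c / enorm (x 0))); rewrite normrN; lra.
    have ext : 0 < enorm (x t).
      by apply: lt_le_trans (lb t (ltW t0)); rewrite mulr_gt0 ?expR_gt0.
    rewrite ler_ln ?posrE ?divr_gt0 ?mulr_gt0 ?expR_gt0 ?divr_gt0 ?invr_gt0 //.
    by rewrite mulrAC ler_wpM2r ?invr_ge0 ?(ltW ex) // lb // ltW.
  by rewrite ler_norml; apply/andP; split; lra.
apply: cvg_lim => //; apply/cvgrPdist_le => eps eps0.
near=> t.
have tK : K / eps + 1 <= t by near: t; apply: nbhs_pinfty_ge; exact: num_real.
have t0 : 0 < t by apply: lt_le_trans tK; rewrite ltr_wpDl // divr_ge0 // ltW.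
apply: le_trans (key t t0) _; rewrite ler_pdivrMr // mulrC -ler_pdivrMr //.
Unshelve. all: by end_near. Qed.

(** This is [exp (t (K - a))] whenever [K^2 = -1], by Euler's formula. *)
Definition rotE d (K : 'M[R]_d) (a t : R) : 'M[R]_d :=
  expR (- (a * t)) *: (cos t *: 1%:M + sin t *: K).

Lemma rotE_coord d (K : 'M[R]_d) a t v i : (rotE K a t *m v) i 0 =
  expR (- (a * t)) * (cos t * v i 0 + sin t * (K *m v) i (0 : 'I_1)).
Proof.
by rewrite /rotE -scalemxAl mulmxDl -!scalemxAl mul1mx !mxE.
Qed.

Lemma rotE_flow d (K : 'M[R]_d) (a : R) : K *m K = - 1%:M ->
  flow (K - a%:M) (rotE K a).
Proof.
move=> KK; split.
  by rewrite /rotE mulr0 oppr0 expR0 cos0 sin0 scale0r addr0 !scale1r.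
move=> t v; apply: is_derive_cV => i.
rewrite (_ : (fun s => _) = (fun s : R => expR (- (a * s))) *
   ((v i 0 \*: cos : R -> R) + ((K *m v) i 0 \*: sin : R -> R))); last first.
  apply/funext => s; rewrite rotE_coord.
  change (expR (- (a * s)) * (cos s * v i 0 + sin s * (K *m v) i 0) =
    expR (- (a * s)) * (v i 0 * cos s + (K *m v) i 0 * sin s)).
  by rewrite [cos s * _]mulrC [sin s * _]mulrC.
have he : is_derive t 1 (fun s : R => expR (- (a * s))) (expR (- (a * t)) * - a).
  apply: (@is_derive1_comp R expR (fun s : R => - (a * s)) t).
  have -> : (fun s : R => - (a * s)) = ((- a) \*: id : R -> R).
    by apply/funext => s; rewrite -mulNr.
  by rewrite -[X in is_derive _ _ _ X]mulr1; apply: is_deriveZ.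
apply: is_derive_eq.
rewrite mulmxBl mul_scalar_mx [RHS]mxE [X in _ = _ + X]mxE [X in _ = _ - X]mxE.
rewrite /rotE -scalemxAl -scalemxAr mulmxDl -!scalemxAl mul1mx mulmxDr -!scalemxAr.
rewrite mulmxA KK mulNmx mul1mx !mxE !fctE /GRing.scale /=.
rewrite -[_ *: cos t]/(_ * _) -[_ *: sin t]/(_ * _).
by ring.
Qed.

Lemma block_flow d1 d2 (A : 'M[R]_d1) (B : 'M[R]_d2) E F :
  flow A E -> flow B F ->
  flow (block_mx A 0 0 B) (fun t => block_mx (E t) 0 0 (F t)).
Proof.
move=> [E0 dE] [F0 dF]; split; first by rewrite E0 F0 -scalar_mx_block.
move=> t v; rewrite -[v]vsubmxK; set v1 := usubmx v; set v2 := dsubmx v.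
apply: is_derive_cV => i.
rewrite !mul_block_col !mul0mx !addr0 !add0r.
have eE s : block_mx (E s) 0 0 (F s) *m col_mx v1 v2 = col_mx (E s *m v1) (F s *m v2).
  by rewrite mul_block_col !mul0mx addr0 add0r.
under eq_fun do rewrite eE.
case: (split_ordP i) => j ->.
  rewrite col_mxEu; under eq_fun do rewrite col_mxEu.
  exact: is_derive_coord.
rewrite col_mxEd; under eq_fun do rewrite col_mxEd.
exact: is_derive_coord.
Qed.

End LyapunovExponent.

(** * The transcendental equation, and functions glued along a switching set *)

Section PlanarGauge.
Variable R : realType.

(** The lines of slope [- m] and [1 / m] are the candidate switching lines. The factor
    [5 / 2 * m / (1 - m ^+ 2)] is the exponent for which the two shifted fields are parallel on
    them; the equation asks that the elliptic angle between the lines, times twice this exponent, be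
    the logarithm of the ratio of [4 x^2 + y^2] at [(1, - m)] and [(m, 1)]. *)
Lemma switching_slope_exists : exists2 m : R, 0 < m < 1 &
  2 * (5 / 2 * m / (1 - m ^+ 2)) * (atan (2 * m)^-1 + atan (m / 2)) =
  ln (4 + m ^+ 2) - ln (1 + 4 * m ^+ 2).
Proof.
pose f (m : R) := 2 * (5 / 2 * m / (1 - m ^+ 2)) * (atan (2 * m)^-1 + atan (m / 2)) -
  (ln (4 + m ^+ 2) - ln (1 + 4 * m ^+ 2)).
have hpi := @pihalf_lt2 R; have hpi2 := @pi_ge2 R.
(* At these endpoints crude bounds on [atan], [ln] and [pi] already decide the sign of [f]. *)
have c : {within `[1 / 100, 1 / 2], continuous f}.
  apply: continuous_in_subspaceT => m; rewrite inE /= in_itv /= => /andP[m1 m2].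
  have cid : y @[y --> m] --> m by exact: cvg_id.
  have c2 : y ^+ 2 @[y --> m] --> m ^+ 2 by exact: cvgM.
  apply: cvgB; [apply: cvgM; [|apply: cvgD]|apply: cvgB].
  - apply: cvgM; first exact: cvg_cst.
    apply: cvgM; first by apply: cvgM; first exact: cvg_cst.
    apply: cvgV; first by apply/eqP; nra.
    by apply: cvgB; first exact: cvg_cst.
  - apply: continuous_cvg; first exact: continuous_atan.
    apply: cvgV; first by apply/eqP; lra.
    by apply: cvgM; first exact: cvg_cst.
  - apply: continuous_cvg; first exact: continuous_atan.
    by apply: cvgM => //; exact: cvg_cst.
  - apply: continuous_cvg; first by apply: continuous_ln; nra.
    by apply: cvgD; first exact: cvg_cst.
  - apply: continuous_cvg; first by apply: continuous_ln; nra.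
    apply: cvgD; first exact: cvg_cst.
    by apply: cvgM; first exact: cvg_cst.
have f1 : f (1 / 100) <= 0.
  rewrite /f; set a := atan _ + atan _.
  have a4 : a <= 4.
    rewrite /a; have := atan_ltpi2 ((2 * (1 / 100 : R))^-1).
    have := atan_ltpi2 (1 / 100 / 2 : R); lra.
  set k := 2 * _.
  have k1 : 0 <= k <= 51 / 1000.
    by rewrite /k (_ : 1 - (1 / 100) ^+ 2 = 9999 / 10000 :> R); lra.
  have h : ln (1 + 4 * (1 / 100 : R) ^+ 2) - ln (4 + (1 / 100 : R) ^+ 2) <= - (1 / 2).
    rewrite -ln_div ?posrE; [|lra|lra].
    set r := (X in ln X); have r2 : r <= 1 / 2 by rewrite /r ler_pdivrMr; lra.
    have r0 : 0 < r by rewrite /r divr_gt0; lra.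
    have -> : r = 1 + (r - 1) by ring.
    have r3 : - 1 < r - 1 by lra.
    by apply: le_trans (le_ln1Dx r3) _; lra.
  case/andP: k1 => k0 k1; have := ler_wpM2l k0 a4. lra.
have f2 : 0 <= f (1 / 2).
  rewrite /f; set a := atan _ + atan _.
  have a4 : 1 / 2 <= a.
    have -> : (1 / 2 : R) = 1 / 2 + 0 by ring.
    apply: lerD; last by rewrite -[leLHS]atan0; apply: le_atan; lra.
    by rewrite (_ : (2 * (1 / 2 : R))^-1 = 1) ?atan1; lra.
  set k := 2 * _.
  have k1 : 3 <= k.
    by rewrite /k (_ : 1 - (1 / 2) ^+ 2 = 3 / 4 :> R); lra.
  have h : ln (4 + (1 / 2 : R) ^+ 2) - ln (1 + 4 * (1 / 2 : R) ^+ 2) <= 9 / 8.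
    rewrite -ln_div ?posrE; [|lra|lra].
    have -> : (4 + (1 / 2 : R) ^+ 2) / (1 + 4 * (1 / 2) ^+ 2) = 1 + 9 / 8.
      by rewrite (_ : 1 + 4 * (1 / 2) ^+ 2 = 2 :> R); lra.
    by apply: le_ln1Dx; lra.
  nra.
have h12 : 1 / 100 <= 1 / 2 :> R by lra.
have [|m] := IVT h12 c (v := 0).
  by rewrite ge_min f1 /= le_max f2 orbT.
rewrite in_itv /= => /andP[m1 m2] fm; exists m; first by apply/andP; split; lra.
by apply/eqP; rewrite -subr_eq0; apply/eqP.
Qed.

(** At a zero of [k] both branches start from the same value and both satisfy the estimate, so it
    does not matter which of them is taken at [t + h] or how often [k] changes sign. The two
    conclusions are what [dini_le] asks on the right and on the left. *)
Lemma switch_dini (f g k : R -> R) (t p q : R) :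
  {for t, continuous k} ->
  (0 <= k t -> is_derive t 1 f p /\ p <= 0) ->
  (k t <= 0 -> is_derive t 1 g q /\ q <= 0) ->
  (k t = 0 -> f t = g t) ->
  let G s := if 0 <= k s then f s else g s in
  forall eps : R, 0 < eps -> exists2 r : R, 0 < r & forall h, `|h| < r ->
    (0 < h -> G (t + h) <= G t + eps * h) /\ G t <= G (t + h) + eps.
Proof.
move=> ck fd gd fg G eps eps0.
have main (F : R -> R) w : is_derive t 1 F w /\ w <= 0 ->
    exists2 r : R, 0 < r & forall h, `|h| < r ->
    (0 < h -> F (t + h) <= F t + eps * h) /\ F t <= F (t + h) + eps.
  case=> dF w0; have [r r0 rP] := is_derive_lin dF eps0.
  have D0 : 0 < eps - w by lra.
  exists (Num.min r (eps / (eps - w))); first by rewrite lt_min r0 divr_gt0.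
  move=> h; rewrite lt_min => /andP[hr]; rewrite ltr_pdivlMr // => hD.
  have := rP h hr; rewrite -[h *: w]/(h * w) ler_norml => /andP[h1 h2].
  split=> [h0|]; first by move: h2; rewrite gtr0_norm //; nra.
  have h3 := ler_norm (- h); rewrite normrN in h3.
  have : h * w >= `|h| * w by have := ler_norm h; nra.
  nra.
have cont (P : R -> Prop) : (\forall y \near k t, P y) ->
    exists2 r : R, 0 < r & forall h, `|h| < r -> P (k (t + h)).
  move=> /ck /nbhs_ballP [r /= r0 rP]; exists r => // h hr.
  by apply: (rP (t + h)); rewrite /ball /= opprD addNKr normrN.
have [kt|kt|kt] := ltgtP (k t) 0.
- have [r1 r10 h1] := main g q (gd (ltW kt)).
  have [r2 r20 h2] := cont _ (lt_nbhsl kt).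
  exists (Num.min r1 r2); first by rewrite lt_min r10.
  move=> h; rewrite lt_min => /andP[hr1 hr2].
  have -> : G (t + h) = g (t + h) by rewrite /G leNgt h2.
  by have -> : G t = g t by [rewrite /G leNgt kt]; exact: h1.
- have [r1 r10 h1] := main f p (fd (ltW kt)).
  have [r2 r20 h2] := cont _ (lt_nbhsr kt).
  exists (Num.min r1 r2); first by rewrite lt_min r10.
  move=> h; rewrite lt_min => /andP[hr1 hr2].
  have -> : G (t + h) = f (t + h) by rewrite /G ltW // h2.
  by have -> : G t = f t by [rewrite /G ltW]; exact: h1.
- have kt0 : 0 <= k t by rewrite kt.
  have kt0' : k t <= 0 by rewrite kt.
  have [r1 r10 h1] := main f p (fd kt0); have [r2 r20 h2] := main g q (gd kt0').
  exists (Num.min r1 r2); first by rewrite lt_min r10.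
  move=> h; rewrite lt_min => /andP[/h1 hr1 /h2 hr2].
  have -> : G t = f t by rewrite /G kt0.
  by rewrite /G; case: ifP => _ //; rewrite fg.
Qed.
End PlanarGauge.

(** * Monotonicity of the gauge along the shifted planar flows *)

Section GaugeMonotone.
Variables (R : realType) (m l : R).
Hypothesis m01 : 0 < m < 1.
Hypothesis lE : l = 5 / 2 * m / (1 - m ^+ 2).
Hypothesis slope : 2 * l * (atan (2 * m)^-1 + atan (m / 2)) =
  ln (4 + m ^+ 2) - ln (1 + 4 * m ^+ 2).

(* The vector fields [C_0 - l] and [C_1 - l] are parallel exactly on the two
   orthogonal lines [sector x y = 0], where the optimal law switches. *)
Definition sector (x y : R) := (m * x + y) * (x - m * y).

(* Along [exp (t C_1)] the form [4 x^2 + y^2] is constant and the elliptic angle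
   [atan (y / (2 x))] grows at unit speed, so that [gauge1] is constant along
   [exp (t (C_1 - l))]. *)
Definition gauge1 (x y : R) :=
  (4 * x ^+ 2 + y ^+ 2) * expR (2 * l * atan (y / (2 * x))).

(** The second branch is [gauge1] after a quarter turn, which exchanges [C_0] and [C_1]; it is
    therefore constant along [exp (t (C_0 - l))]. *)
Definition gauge (x y : R) :=
  if 0 <= sector x y then gauge1 x y else gauge1 (- y) x.

Lemma rate_gt0 : 0 < l.
Proof.
case/andP: m01 => m0 m1; rewrite lE divr_gt0 //; first lra.
by rewrite subr_gt0 expr_lt1 // ltW.
Qed.

Lemma gauge1Z a x y : a != 0 -> gauge1 (a * x) (a * y) = a ^+ 2 * gauge1 x y.
Proof.
move=> a0; rewrite /gauge1.
have -> : a * y / (2 * (a * x)) = y / (2 * x).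
  have [->|x0] := eqVneq x 0; first by rewrite !mulr0 !invr0 !mulr0.
  by field; rewrite a0 x0.
by ring.
Qed.

(** The equation [slope] is the logarithm of this identity, which makes the two branches of [gauge]
    agree on the switching lines. *)
Lemma gauge1_corner : gauge1 1 (- m) = gauge1 m 1.
Proof.
case/andP: m01 => m0 m1; rewrite /gauge1.
have -> : - m / (2 * 1) = - (m / 2) by rewrite mulr1 mulNr.
rewrite div1r atanN expr1n sqrrN mulr1 addrC.
have h1 : 0 < m ^+ 2 + 4 by nra.
have h2 : 0 < 4 * m ^+ 2 + 1 by nra.
rewrite -[m ^+ 2 + 4]lnK ?posrE // -[4 * m ^+ 2 + 1]lnK ?posrE //.
rewrite -!expRD; congr expR; move: slope.
by rewrite [4 + _]addrC [1 + _]addrC; lra.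
Qed.

Lemma gauge1_boundary x y : sector x y = 0 -> gauge1 x y = gauge1 (- y) x.
Proof.
case/andP: m01 => m0 _; move/eqP; rewrite mulf_eq0 => /orP[] /eqP h.
  have -> : y = x * - m by lra.
  have [->|x0] := eqVneq x 0; first by rewrite mul0r oppr0.
  have -> : - (x * - m) = x * m by ring.
  have <- : x ^+ 2 * gauge1 1 (- m) = gauge1 x (x * - m).
    by rewrite -gauge1Z // mulr1.
  by rewrite gauge1_corner -gauge1Z // mulr1.
have -> : x = y * m by lra.
have [->|y0] := eqVneq y 0; first by rewrite mul0r oppr0.
have <- : y ^+ 2 * gauge1 m 1 = gauge1 (y * m) y.
  by rewrite -gauge1Z // mulr1.
by rewrite -gauge1_corner -[y ^+ 2]sqrrN -gauge1Z ?oppr_eq0 // mulr1 mulrNN.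
Qed.

(** The elliptic angle has derivative [2 (dy x - y dx) / (4 x^2 + y^2)], and its denominator cancels
    the quadratic form. *)
Lemma gauge1_derive (x y : R -> R) (t dx dy : R) : x t != 0 ->
  is_derive t 1 x dx -> is_derive t 1 y dy ->
  is_derive t 1 (fun s => gauge1 (x s) (y s))
    (expR (2 * l * atan (y t / (2 * x t))) *
     (8 * x t * dx + 2 * y t * dy + 4 * l * (dy * x t - y t * dx))).
Proof.
move=> x0 Dx Dy; have x20 : 2 * x t != 0 by rewrite mulf_neq0.
have D2x : is_derive t 1 (fun s => 2 * x s) (2 * dx) by exact: (is_deriveZ 2 Dx).
have Di := @is_deriveV R (fun s => 2 * x s) t (2 * dx) 1 x20 D2x.
have Dq : is_derive t 1 (fun s => y s / (2 * x s)) _ := is_deriveM Dy Di.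
have Da := @is_derive1_comp R atan (fun s => y s / (2 * x s)) t _ _ (is_derive1_atan _) Dq.
have Dla : is_derive t 1 (fun s => 2 * l * atan (y s / (2 * x s))) _ := is_deriveZ (2 * l) Da.
have De := @is_derive1_comp R expR (fun s => 2 * l * atan (y s / (2 * x s)))
  t _ _ (is_derive_expR _) Dla.
have Dx2 : is_derive t 1 (fun s => x s * x s) _ := is_deriveM Dx Dx.
have Dy2 : is_derive t 1 (fun s => y s * y s) _ := is_deriveM Dy Dy.
have D4x : is_derive t 1 (fun s => 4 * (x s * x s)) _ := is_deriveZ 4 Dx2.
have Dp : is_derive t 1 (fun s => 4 * (x s * x s) + y s * y s) _ := is_deriveD D4x Dy2.
have Dg : is_derive t 1 (fun s => (4 * (x s * x s) + y s * y s) *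
  expR (2 * l * atan (y s / (2 * x s)))) _ := is_deriveM Dp De.
have -> : (fun s => gauge1 (x s) (y s)) = (fun s => (4 * (x s * x s) + y s * y s) *
  expR (2 * l * atan (y s / (2 * x s)))).
  by apply/funext => s; rewrite /gauge1 !expr2.
apply: is_derive_eq Dg _; rewrite /GRing.scale /=.
set e := expR _.
have x0' : 4 * x t ^+ 2 + y t ^+ 2 != 0.
  by rewrite gt_eqF // ltr_pwDl ?sqr_ge0 // mulr_gt0 // exprn_even_gt0.
have x0'' : 1 + (y t / (2 * x t)) ^+ 2 != 0.
  by rewrite gt_eqF // ltr_pwDl ?sqr_ge0.
field.
by rewrite x0 /=; move: x0'; rewrite (_ : 4 * x t ^+ 2 = (2 * x t) ^+ 2) //; ring.
Qed.

(** The equations are those of [C_0 - l]; the case of [C_1] follows by a quarter turn. The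
    derivative vanishes on the branch adapted to [C_0]; on the other one it is a negative multiple
    of [sector], by the choice of [l]. *)
Lemma gauge_flow_le (x y : R -> R) (b : R) : 0 <= b ->
  (forall t : R, is_derive t 1 x (- (l * x t) - 2 * y t)) ->
  (forall t : R, is_derive t 1 y (x t / 2 - l * y t)) ->
  (forall t : R, x t != 0 \/ y t != 0) ->
  gauge (x b) (y b) <= gauge (x 0) (y 0).
Proof.
move=> b0 Dx Dy xy0; case/andP: m01 => m0 m1.
have key (t eps : R) : 0 < eps -> exists2 r : R, 0 < r & forall h, `|h| < r ->
  (0 < h -> gauge (x (t + h)) (y (t + h)) <= gauge (x t) (y t) + eps * h) /\
  gauge (x t) (y t) <= gauge (x (t + h)) (y (t + h)) + eps.
  move=> eps0.
  have Da : is_derive t 1 (fun s => m * x s + y s) _ :=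
    is_deriveD (is_deriveZ m (Dx t)) (Dy t).
  have Db : is_derive t 1 (fun s => x s - m * y s) _ :=
    is_deriveB (Dx t) (is_deriveZ m (Dy t)).
  have Ds : is_derive t 1 (fun s => sector (x s) (y s)) _ := is_deriveM Da Db.
  have cs : {for t, continuous (fun s => sector (x s) (y s))}.
    by apply/differentiable_continuous/derivable1_diffP; case: Ds.
  pose p := expR (2 * l * atan (y t / (2 * x t))) *
     (8 * x t * (- (l * x t) - 2 * y t) + 2 * y t * (x t / 2 - l * y t) +
      4 * l * ((x t / 2 - l * y t) * x t - y t * (- (l * x t) - 2 * y t))).
  pose f s := gauge1 (x s) (y s); pose g s := gauge1 (- y s) (x s).
  have Df : 0 <= sector (x t) (y t) -> is_derive t 1 f p /\ p <= 0.
    move=> st; have xt : x t != 0.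
      apply/eqP => xt; case: (xy0 t); rewrite ?xt ?eqxx //.
      move: st; rewrite /sector xt; set w := y t => st w0.
      have : 0 < w ^+ 2 by rewrite exprn_even_gt0.
      by move: st; nra.
    split; first exact: gauge1_derive.
    rewrite /p pmulr_rle0 ?expR_gt0 //.
    have hm : 0 < 1 - m ^+ 2 by nra.
    set w := (X in X <= 0).
    have -> : w = - (15 / (1 - m ^+ 2)) * sector (x t) (y t).
      by rewrite /w /sector lE; field; rewrite gt_eqF.
    by rewrite mulNr oppr_le0 mulr_ge0 // divr_ge0 // ltW.
  have Dg : sector (x t) (y t) <= 0 -> is_derive t 1 g 0 /\ (0 : R) <= 0.
    move=> st; have yt : y t != 0.
      apply/eqP => yt; case: (xy0 t); rewrite ?yt ?eqxx //.
      move: st; rewrite /sector yt; set w := x t => st w0.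
      have : 0 < w ^+ 2 by rewrite exprn_even_gt0.
      by move: st; nra.
    split; last exact: lexx.
    have yt' : - y t != 0 by rewrite oppr_eq0.
    have Dny : is_derive t 1 (fun s => - y s) _ := is_deriveN (Dy t).
    have := @gauge1_derive (fun s => - y s) x t _ _ yt' Dny (Dx t).
    set w := (X in _ * X); have -> : w = 0 by rewrite /w; field.
    by rewrite mulr0.
  have fg : sector (x t) (y t) = 0 -> f t = g t by exact: gauge1_boundary.
  have [r r0 rP] := switch_dini cs Df Dg fg eps0.
  by exists r => // h hr; exact: (rP h hr).
apply/ler_addgt0Pr => eps eps0.
have b1 : 0 < b + 1 by rewrite ltr_wpDl.
pose e := eps / (b + 1); have e0 : 0 < e by rewrite divr_gt0.
apply: (@le_trans _ _ (gauge (x 0) (y 0) + (0 - 0) + e * (b - 0))).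
  apply: (@dini_le R (fun t => gauge (x t) (y t)) (fun=> 0)) => //.
  - move=> t _ eps' eps'0; have [r r0 rP] := key t _ eps'0; exists r => // s _ ts st.
    have [|_] := rP (s - t); first by rewrite ler0_norm ?subr_le0 //; lra.
    by rewrite [t + _]addrC subrK.
  - move=> t _; have [r r0 rP] := key t _ e0; exists r => // h /andP[h0 hr] _.
    by rewrite subrr addr0; apply: (rP h _).1 => //; rewrite gtr0_norm.
rewrite subr0 addr0 subr0 lerD2l /e mulrAC ler_pdivrMr //.
by rewrite ler_wpM2l ?(ltW eps0) // lerDl.
Qed.

Lemma gauge_ge x y : expR (- (l * pi)) * (x ^+ 2 + y ^+ 2) <= gauge x y.
Proof.
have h1 u v : expR (- (l * pi)) * (u ^+ 2 + v ^+ 2) <= gauge1 u v.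
  rewrite /gauge1 mulrC; apply: ler_pM; rewrite ?addr_ge0 ?sqr_ge0 ?expR_ge0 //.
    by rewrite lerD2r ler_peMl ?sqr_ge0 // ler1n.
  rewrite ler_expR; have := atan_gtNpi2 (v / (2 * u)); have := rate_gt0; nra.
rewrite /gauge; case: ifP => _; first exact: h1.
by have := h1 (- y) x; rewrite sqrrN [y ^+ 2 + _]addrC.
Qed.

Lemma gauge_le x y : gauge x y <= 4 * expR (l * pi) * (x ^+ 2 + y ^+ 2).
Proof.
have h1 u v : gauge1 u v <= 4 * expR (l * pi) * (u ^+ 2 + v ^+ 2).
  rewrite /gauge1 [leRHS]mulrAC; apply: ler_pM; rewrite ?expR_ge0 //.
  - by have := sqr_ge0 u; have := sqr_ge0 v; lra.
  - by rewrite mulrDr lerD2l ler_peMl ?sqr_ge0 // ler1n.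
  - rewrite ler_expR; have := atan_ltpi2 (v / (2 * u)); have := rate_gt0; nra.
rewrite /gauge; case: ifP => _; first exact: h1.
by have := h1 (- y) x; rewrite sqrrN [y ^+ 2 + _]addrC.
Qed.

Lemma gauge_rot x y : gauge (- y) x = gauge x y.
Proof.
rewrite /gauge; have -> : sector (- y) x = - sector x y by rewrite /sector; ring.
have gN : gauge1 (- x) (- y) = gauge1 x y.
  have := @gauge1Z (- 1) x y; rewrite oppr_eq0 oner_eq0 => /(_ isT).
  by rewrite !mulN1r sqrrN expr1n mul1r.
rewrite oppr_ge0; have [s0|s0|s0] := ltgtP (sector x y) 0 => //.
exact: esym (gauge1_boundary s0).
Qed.

End GaugeMonotone.

(** * The planar pair and its periodic orbit *)

Section PlanarSystem.
Variable R : realType.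

Definition vec2 (x y : R) : 'cV[R]_2 := \col_(i < 2) [:: x; y]`_i.

Lemma vec2E (v : 'cV[R]_2) : v = vec2 (v 0 0) (v 1 0).
Proof.
by apply/colP => -[[|[|//]] i]; rewrite mxE /=; congr (v _ _); apply/val_inj.
Qed.

Lemma vec2_0 (x y : R) : vec2 x y 0 0 = x. Proof. by rewrite mxE. Qed.
Lemma vec2_1 (x y : R) : vec2 x y 1 0 = y. Proof. by rewrite mxE. Qed.

Lemma vec2Z (a x y : R) : a *: vec2 x y = vec2 (a * x) (a * y).
Proof. by apply/colP => -[[|[|//]] i]; rewrite !mxE. Qed.

Lemma vec2D (x y x' y' : R) : vec2 x y + vec2 x' y' = vec2 (x + x') (y + y').
Proof. by apply/colP => -[[|[|//]] i]; rewrite !mxE. Qed.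

Lemma mx_of_rows_vec2 (a b c d x y : R) :
  mx_of_rows 2 2 [:: [:: a; b]; [:: c; d]] *m vec2 x y =
  vec2 (a * x + b * y) (c * x + d * y).
Proof.
by apply/colP => -[[|[|//]] i]; rewrite !mxE !big_ord_recl big_ord0 !mxE /= addr0.
Qed.

(* [cmx true] and [cmx false] are the matrices of the theorem whose exponent is
   [lam]; the quarter turn [qrot] exchanges them. *)
Definition cmx (i : bool) : 'M[R]_2 :=
  if i then mx_of_rows 2 2 [:: [:: 0; - 2^-1]; [:: 2; 0]]
  else mx_of_rows 2 2 [:: [:: 0; -2]; [:: 2^-1; 0]].

Definition qrot : 'M[R]_2 := mx_of_rows 2 2 [:: [:: 0; -1]; [:: 1; 0]].

Lemma mulmx2P (A B : 'M[R]_2) :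
  (forall x y, A *m vec2 x y = B *m vec2 x y) -> A = B.
Proof.
move=> AB; apply/matrixP => i j; have := AB (j == 0)%:R (j == 1)%:R.
have -> : vec2 (j == 0)%:R (j == 1)%:R = delta_mx j 0.
  by apply/colP; case: j => -[|[|//]] j [[|[|//]] k]; rewrite !mxE.
by rewrite -!colE => /matrixP /(_ i 0); rewrite !mxE.
Qed.

Lemma cmx_vec2 i x y : cmx i *m vec2 x y =
  if i then vec2 (- (y / 2)) (2 * x) else vec2 (- (2 * y)) (x / 2).
Proof. by case: i; rewrite mx_of_rows_vec2; congr vec2; ring. Qed.

Lemma qrot_vec2 x y : qrot *m vec2 x y = vec2 (- y) x.
Proof. by rewrite mx_of_rows_vec2; congr vec2; ring. Qed.

Lemma cmx_sqr i : cmx i *m cmx i = - 1%:M.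
Proof.
apply: mulmx2P => x y; rewrite -mulmxA mulNmx mul1mx -scaleN1r vec2Z.
by case: i; rewrite !cmx_vec2; congr vec2; field.
Qed.

Lemma qrot_sqr : qrot *m qrot = - 1%:M.
Proof.
apply: mulmx2P => x y; rewrite -mulmxA mulNmx mul1mx -scaleN1r vec2Z.
by rewrite !qrot_vec2; congr vec2; ring.
Qed.

Lemma qrot_cmx i : qrot *m cmx i = cmx (~~ i) *m qrot.
Proof.
apply: mulmx2P => x y; rewrite -!mulmxA.
by case: i; rewrite ?(cmx_vec2, qrot_vec2) /=; congr vec2; field.
Qed.

Lemma rotED d (K : 'M[R]_d) a s t : K *m K = - 1%:M ->
  rotE K a s *m rotE K a t = rotE K a (s + t).
Proof.
move=> KK; rewrite /rotE -scalemxAl -scalemxAr scalerA -expRD.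
have -> : - (a * s) + - (a * t) = - (a * (s + t)) by ring.
congr (_ *: _); rewrite mulmxDl !mulmxDr -!scalemxAl -!scalemxAr !mul1mx mulmx1 KK.
apply/matrixP => i j; rewrite cosD sinD !mxE; set e := _ *+ _.
by ring.
Qed.

Lemma rotE0 d (K : 'M[R]_d) a : rotE K a 0 = 1%:M.
Proof. by rewrite /rotE mulr0 oppr0 expR0 cos0 sin0 scale0r addr0 !scale1r. Qed.

Lemma rotE_rate d (K : 'M[R]_d) a b t :
  rotE K a t = expR ((b - a) * t) *: rotE K b t.
Proof. by rewrite /rotE scalerA -expRD; congr (expR _ *: _); ring. Qed.

Lemma qrot_rotE i a t : qrot *m rotE (cmx i) a t = rotE (cmx (~~ i)) a t *m qrot.
Proof.
by rewrite /rotE -scalemxAr -scalemxAl mulmxDr mulmxDl -!scalemxAr -!scalemxAl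
  mulmx1 mul1mx qrot_cmx.
Qed.

Lemma rotE_cmx_vec2 i a t x y : rotE (cmx i) a t *m vec2 x y =
  expR (- (a * t)) *: (if i then vec2 (cos t * x - sin t * y / 2) (cos t * y + 2 * sin t * x)
  else vec2 (cos t * x - 2 * sin t * y) (cos t * y + sin t * x / 2)).
Proof.
rewrite /rotE -scalemxAl mulmxDl -!scalemxAl mul1mx cmx_vec2; congr (_ *: _).
by case: i; rewrite !vec2Z vec2D; congr vec2; ring.
Qed.

Definition quarter k (v : 'cV[R]_2) := iter k (mulmx qrot) v.

Lemma rotE_quarter k a t v :
  rotE (cmx (~~ odd k)) a t *m quarter k v = quarter k (rotE (cmx true) a t *m v).
Proof.
elim: k => //= k IH; rewrite negbK -IH !mulmxA; congr (_ *m _).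
by rewrite qrot_rotE negbK.
Qed.

Lemma quarterSS k v : quarter k.+2 v = - quarter k v.
Proof. by rewrite /= mulmxA qrot_sqr mulNmx mul1mx. Qed.

Lemma quarterSr k v : quarter k (qrot *m v) = quarter k.+1 v.
Proof. by rewrite /quarter -iterSr. Qed.

Section Orbit.
Variables (m l : R).
Hypothesis m01 : 0 < m < 1.
Hypothesis lE : l = 5 / 2 * m / (1 - m ^+ 2).
Hypothesis slope : 2 * l * (atan (2 * m)^-1 + atan (m / 2)) =
  ln (4 + m ^+ 2) - ln (1 + 4 * m ^+ 2).

Let l0 : 0 < l := rate_gt0 m01 lE.

Definition switch_pt := vec2 1 (- m).
(** The elliptic angle, which grows at unit speed along [C_1], from [switch_pt] to its quarter turn
    [(m, 1)]. *)
Definition switch_time := atan (2 * m)^-1 + atan (m / 2).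

Let T := switch_time.
Let w0 := switch_pt.

Lemma switch_time_gt0 : 0 < T.
Proof.
case/andP: m01 => m0 m1.
have h1 : 0 < (2 * m)^-1 by rewrite invr_gt0; lra.
have h2 : 0 < m / 2 by lra.
by rewrite /T /switch_time addr_gt0 // -[ltLHS]atan0; apply: lt_atan.
Qed.

Let cos_atan_gt0 (x : R) : 0 < cos (atan x).
Proof. by apply: cos_gt0_pihalf; rewrite atan_gtNpi2 atan_ltpi2. Qed.

Let sin_atan (x : R) : sin (atan x) = x * cos (atan x).
Proof.
have c0 := cos_atan_gt0 x.
by rewrite -{2}[x]atanK /tan divfK // gt_eqF.
Qed.

(** The point [(cos b, 2 sin b)] has elliptic angle [b]; the orbit starts at angle [- atan (m / 2)],
    and time adds to the angle. *)
Lemma orbitE (b : R) : rotE (cmx true) l (b + atan (m / 2)) *m w0 =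
  (expR (- (l * (b + atan (m / 2)))) / cos (atan (m / 2))) *:
  vec2 (cos b) (2 * sin b).
Proof.
have c0 := cos_atan_gt0 (m / 2).
have c1 := cos2Dsin2 (atan (m / 2)); rewrite sin_atan in c1.
rewrite rotE_cmx_vec2 -scalerA; congr (_ *: _); rewrite vec2Z cosD sinD sin_atan.
set c := cos (atan _) in c0 c1 *.
have e : c^-1 = c + m / 2 * (m / 2 * c).
  by rewrite -[LHS]mulr1 -[X in _ * X = _]c1; field; rewrite gt_eqF.
by congr vec2; rewrite e; field.
Qed.

(** The flow meets the line of [qrot *m w0] at time [T] by the choice of [T]; that it lands on this
    very point, with scale factor 1, is the equation [slope]. *)
Lemma orbit_switch : rotE (cmx true) l T *m w0 = qrot *m w0.
Proof.
case/andP: m01 => m0 m1.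
rewrite /T /switch_time orbitE qrot_vec2 opprK.
set b := atan (2 * m)^-1; set a := atan (m / 2).
have ca := cos_atan_gt0 (m / 2); have cb := cos_atan_gt0 (2 * m)^-1.
have sb := sin_atan (2 * m)^-1.
have c1 := cos2Dsin2 a; rewrite sin_atan in c1.
have c2 := cos2Dsin2 b; rewrite sb in c2.
(* Compared after squaring: [slope] contains [2 * l], and the squared cosines are rational in
   [m]. *)
have eT : expR (l * (b + a)) = cos b / (m * cos a).
  apply: (@pexpIrn _ 2) => //; rewrite ?nnegrE ?expR_ge0 //.
    by rewrite divr_ge0 ?mulr_ge0 ?(ltW ca) ?(ltW cb) ?(ltW m0).
  rewrite expr2 -expRD (_ : _ + _ = ln (4 + m ^+ 2) - ln (1 + 4 * m ^+ 2)); last first.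
    by rewrite -slope /b /a; ring.
  have h1 : 0 < 4 + m ^+ 2 by nra.
  have h2 : 0 < 1 + 4 * m ^+ 2 by nra.
  rewrite expRD expRN !lnK ?posrE //.
  have h3 : cos a ^+ 2 * (4 + m ^+ 2) = 4 by rewrite -[RHS]mulr1 -[X in _ = _ * X]c1; field.
  have h4 : cos b ^+ 2 * (1 + 4 * m ^+ 2) = 4 * m ^+ 2.
    by rewrite -[RHS]mulr1 -[X in _ = _ * X]c2; field; rewrite gt_eqF.
  have n1 : 1 + 4 * m ^+ 2 != 0 by rewrite gt_eqF.
  have n2 : m ^+ 2 * cos a ^+ 2 != 0 by rewrite gt_eqF // mulr_gt0 // exprn_gt0.
  apply/eqP; rewrite expr_div_n exprMn eqr_div // h4 mulrCA.
  by rewrite [_ * cos a ^+ 2]mulrC h3 mulrC.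
rewrite expRN eT invf_div vec2Z sb.
congr vec2; field; rewrite ?(gt_eqF cb, gt_eqF ca) ?gt_eqF //.
Qed.

(** Where [sector] is nonnegative, the tangent [p] of the elliptic angle lies between its values at
    the two ends of the arc; elsewhere a quarter turn back changes the sign of [sector]. *)
Lemma orbit_cover w : exists r t (k : nat), [/\ 0 <= t, t <= T &
  w = r *: quarter k (rotE (cmx true) l t *m w0)].
Proof.
case/andP: m01 => m0 m1.
have main (x y : R) : 0 <= sector m x y -> exists r t,
    [/\ 0 <= t, t <= T & vec2 x y = r *: (rotE (cmx true) l t *m w0)].
  move=> s0; have [x0|x0] := eqVneq x 0.
    have y0 : y = 0.
      apply/eqP; rewrite -sqrf_eq0 eq_le sqr_ge0 andbT.
      move: s0; rewrite /sector x0 (_ : _ * _ = - (m * y ^+ 2)); last by ring.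
      by rewrite oppr_ge0 pmulr_rle0.
    exists 0, 0; rewrite lexx ltW ?switch_time_gt0 // scale0r x0 y0; split=> //.
    by apply/colP => -[[|[|//]] i]; rewrite !mxE.
  pose p := y / (2 * x); have yE : y = 2 * p * x by rewrite /p; field.
  have x2 : 0 < x ^+ 2 by rewrite exprn_even_gt0.
  have s1 : 0 <= (m + 2 * p) * (1 - m * (2 * p)).
    rewrite -(pmulr_rge0 _ x2); move: s0; rewrite /sector yE.
    by rewrite (_ : _ * _ = x ^+ 2 * ((m + 2 * p) * (1 - m * (2 * p)))) //; ring.
  have p1 : - (m / 2) <= p.
    rewrite leNgt; apply/negP => p1; move: s1; apply/negP; rewrite -ltNge.
    have h1 : 0 < 1 - m * (2 * p) by nra.
    by rewrite pmulr_llt0 //; lra.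
  have p2 : p <= (2 * m)^-1.
    rewrite -[(2 * m)^-1]mul1r ler_pdivlMr; last lra.
    rewrite leNgt; apply/negP => p2; move: s1; apply/negP; rewrite -ltNge.
    have h1 : 0 < m + 2 * p by nra.
    by rewrite pmulr_rlt0 //; lra.
  pose b := atan p; have cb : 0 < cos b := cos_atan_gt0 p.
  have ca := cos_atan_gt0 (m / 2).
  exists (x * expR (l * (b + atan (m / 2))) * cos (atan (m / 2)) / cos b), (b + atan (m / 2)).
  split.
  - by rewrite -[atan (m / 2)]opprK subr_ge0 -atanN; apply: le_atan.
  - by rewrite lerD2r; apply: le_atan.
  rewrite orbitE scalerA vec2Z expRN.
  have e0 := expR_gt0 (l * (b + atan (m / 2))).
  have -> : sin b = p * cos b by exact: sin_atan.
  by rewrite yE; congr vec2; field; rewrite ?gt_eqF.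
have [s0|s0] := leP 0 (sector m (w 0 0) (w 1 0)).
  have [r [t [t0 tT wE]]] := main _ _ s0.
  by exists r, t, 0%N; split => //; rewrite [LHS]vec2E.
have s1 : 0 <= sector m (w 1 0) (- w 0 0).
  by move: s0; rewrite /sector; lra.
have [r [t [t0 tT wE]]] := main _ _ s1.
exists r, t, 1%N; split => //.
by rewrite /quarter /= scalemxAr -wE qrot_vec2 opprK -vec2E.
Qed.

Section Homogeneous.
Variable f : 'cV[R]_2 -> R.
Hypothesis fZ : forall (a : R) v, f (a *: v) = `|a| * f v.
Hypothesis f_flow : forall i (t : R) v, 0 <= t -> f (rotE (cmx i) l t *m v) <= f v.

(** Two arcs lead from [w0] to [- w0], where the even function [f] has the same value; being
    nonincreasing along them, it is constant. Further quarter turns only change signs. *)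
Lemma homogeneous_orbit k t : 0 <= t -> t <= T ->
  f (quarter k (rotE (cmx true) l t *m w0)) = f w0.
Proof.
have fN v : f (- v) = f v by rewrite -scaleN1r fZ normrN1 mul1r.
move=> t0 tT.
have T0 : 0 <= T - t by rewrite subr_ge0.
have h i u : f (rotE (cmx i) l (T - t) *m (rotE (cmx i) l t *m u)) =
    f (rotE (cmx i) l T *m u).
  by rewrite mulmxA rotED ?cmx_sqr // subrK.
have e1 : f (rotE (cmx true) l t *m w0) <= f w0 := f_flow _ _ t0.
have e2 : f (qrot *m w0) <= f (rotE (cmx true) l t *m w0).
  by rewrite -orbit_switch -h; exact: f_flow.
have e3 : f (qrot *m (rotE (cmx true) l t *m w0)) <= f (qrot *m w0).
  by rewrite mulmxA qrot_rotE -mulmxA; exact: f_flow.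
have e4 : f w0 <= f (qrot *m (rotE (cmx true) l t *m w0)).
  have -> : f w0 = f (rotE (cmx false) l T *m (qrot *m w0)).
    rewrite mulmxA -(qrot_rotE true) -mulmxA orbit_switch mulmxA qrot_sqr.
    by rewrite mulNmx mul1mx fN.
  by rewrite -h [in leRHS]mulmxA qrot_rotE -mulmxA; exact: f_flow.
have f0 : f (rotE (cmx true) l t *m w0) = f w0 by lra.
have f1 : f (qrot *m (rotE (cmx true) l t *m w0)) = f w0 by lra.
suff : f (quarter k (rotE (cmx true) l t *m w0)) = f w0 /\
       f (quarter k.+1 (rotE (cmx true) l t *m w0)) = f w0 by case.
by elim: k => [//|k [IH1 IH2]]; split => //; rewrite quarterSS fN.
Qed.

End Homogeneous.
End Orbit.
End PlanarSystem.

(** * The planar extremal norm and the value of [lam] *)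

Section PlanarNorm.
Variables (R : realType) (l : R).
Implicit Types (v w : 'cV[R]_2) (P Q : 'M[R]_2) (t : R).

Inductive planar_sgrp : 'M[R]_2 -> Prop :=
| planar_sgrp1 : planar_sgrp 1%:M
| planar_sgrpM P Q : planar_sgrp P -> planar_sgrp Q -> planar_sgrp (P *m Q)
| planar_sgrp_rotE i t : 0 <= t -> planar_sgrp (rotE (cmx R i) l t).

(** A supremum of seminorms is convex by construction, whereas the convexity of the square root of
    [gauge] is not evident. [gauge] serves to bound the semigroup; by [planar_extremal_unique] its
    root is in fact a multiple of this norm. *)
Definition planar_norm (v : 'cV[R]_2) := sup [set `|P *m v| | P in planar_sgrp].

Variable m : R.
Hypothesis m01 : 0 < m < 1.
Hypothesis lE : l = 5 / 2 * m / (1 - m ^+ 2).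
Hypothesis slope : 2 * l * (atan (2 * m)^-1 + atan (m / 2)) =
  ln (4 + m ^+ 2) - ln (1 + 4 * m ^+ 2).

Let l0 : 0 < l := rate_gt0 m01 lE.

Definition vgauge (v : 'cV[R]_2) := gauge m l (v 0 0) (v 1 0).

Lemma vgauge_qrot v : vgauge (qrot R *m v) = vgauge v.
Proof. by rewrite [v]vec2E qrot_vec2 /vgauge !vec2_0 !vec2_1 gauge_rot. Qed.

Lemma vgauge_rotE_false t v : 0 <= t ->
  vgauge (rotE (cmx R false) l t *m v) <= vgauge v.
Proof.
move=> t0; have [->|v0] := eqVneq v 0; first by rewrite mulmx0.
pose x i s := (rotE (cmx R false) l s *m v) i 0.
have x0 i : x i 0 = v i 0 by rewrite /x rotE0 mul1mx.
have [_ D] := rotE_flow l (cmx_sqr R false).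
have E (w : 'cV[R]_2) : (cmx R false - l%:M) *m w =
    vec2 (- (l * w 0 0) - 2 * w 1 0) (w 0 0 / 2 - l * w 1 0).
  rewrite mulmxBl mul_scalar_mx -scaleNr.
  move: (w 0 0) (w 1 0) (vec2E w) => x0' x1' ->; rewrite cmx_vec2 vec2Z vec2D.
  by congr vec2; ring.
have := @gauge_flow_le R m l m01 lE slope (x 0) (x 1) t t0.
rewrite !x0; apply.
- by move=> s; have := is_derive_coord 0 (D s v); rewrite E vec2_0.
- by move=> s; have := is_derive_coord 1 (D s v); rewrite E vec2_1.
move=> s; apply/orP; rewrite -negb_and; apply: contra v0 => /andP[/eqP h0 /eqP h1].
(* The flow is invertible, so only the zero vector is ever carried to 0. *)
rewrite -[v]mul1mx -(rotE0 (cmx R false) l) -(addNr s) -rotED ?cmx_sqr // -mulmxA.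
have -> : rotE (cmx R false) l s *m v = 0.
  rewrite [LHS]vec2E -/(x 0 s) -/(x 1 s) h0 h1.
  by apply/colP => -[[|[|//]] k]; rewrite !mxE.
by rewrite mulmx0.
Qed.

Lemma vgauge_rotE i t v : 0 <= t -> vgauge (rotE (cmx R i) l t *m v) <= vgauge v.
Proof.
case: i; last exact: vgauge_rotE_false.
move=> t0; rewrite -vgauge_qrot mulmxA qrot_rotE -mulmxA.
by apply: le_trans (vgauge_rotE_false _ t0) _; rewrite vgauge_qrot.
Qed.

Lemma enorm2_sqr (v : 'cV[R]_2) : enorm v ^+ 2 = v 0 0 ^+ 2 + v 1 0 ^+ 2.
Proof.
rewrite sqr_sqrtr; last by apply: sumr_ge0 => i _; exact: sqr_ge0.
rewrite !big_ord_recl big_ord0 addr0; congr (_ + v _ _ ^+ 2).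
exact/val_inj.
Qed.

(** The constant is the square root of the ratio [4 e^(2 l pi)] of the bounds in [gauge_le] and
    [gauge_ge]. *)
Lemma planar_sgrp_bound P v : planar_sgrp P ->
  `|P *m v| <= 2 * expR (l * pi) * enorm v.
Proof.
move=> SP; have gP : vgauge (P *m v) <= vgauge v.
  elim: SP v => [v|P1 Q1 _ IH1 _ IH2 v|i t t0 v]; first by rewrite mul1mx.
    by rewrite -mulmxA; apply: le_trans (IH1 _) (IH2 _).
  exact: vgauge_rotE.
apply: le_trans (norm_le_enorm _) _.
rewrite -(@ler_pXn2r _ 2) ?nnegrE ?enorm_ge0 ?mulr_ge0 ?enorm_ge0 ?expR_ge0 //.
rewrite exprMn enorm2_sqr enorm2_sqr.
have h1 := gauge_ge m01 lE ((P *m v) 0 0) ((P *m v) 1 0).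
have h2 := gauge_le m01 lE (v 0 0) (v 1 0).
have e0 := expR_gt0 (l * pi).
rewrite expRN -ler_pdivlMl ?invr_gt0 // invrK in h1.
apply: le_trans h1 _; rewrite exprMn -mulrA.
apply: (@le_trans _ _ (expR (l * pi) * (4 * expR (l * pi) * (v 0 0 ^+ 2 + v 1 0 ^+ 2)))).
  by rewrite ler_pM2l //; apply: le_trans h2.
by rewrite le_eqVlt; apply/orP; left; apply/eqP; ring.
Qed.

Let planar_has_sup v : has_sup [set `|P *m v| | P in planar_sgrp].
Proof.
split; first by exists `|1%:M *m v|, 1%:M => //; exact: planar_sgrp1.
by exists (2 * expR (l * pi) * enorm v) => _ [P SP <-]; exact: planar_sgrp_bound.
Qed.

Lemma planar_norm_ub P v : planar_sgrp P -> `|P *m v| <= planar_norm v.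
Proof. by move=> SP; apply: sup_upper_bound => //; exists P. Qed.

Lemma planar_norm_lub v c : (forall P, planar_sgrp P -> `|P *m v| <= c) ->
  planar_norm v <= c.
Proof.
by move=> h; apply: ge_sup => [|_ [P SP <-]]; [case: (planar_has_sup v)|exact: h].
Qed.

Lemma norm_le_planar_norm v : `|v| <= planar_norm v.
Proof. by rewrite -{1}[v]mul1mx; apply: planar_norm_ub; exact: planar_sgrp1. Qed.

Lemma planar_norm_is_norm : is_norm planar_norm.
Proof.
split.
- by move=> v; apply: le_trans (norm_le_planar_norm v).
- move=> v v0; apply/eqP; rewrite -normr_le0 -v0; exact: norm_le_planar_norm.
- have le1 (a : R) v : planar_norm (a *: v) <= `|a| * planar_norm v.
    apply: planar_norm_lub => P SP; rewrite -scalemxAr normrZ ler_wpM2l //.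
    exact: planar_norm_ub.
  move=> a v; apply/eqP; rewrite eq_le le1 /=.
  have [->|a0] := eqVneq a 0.
    rewrite scale0r normr0 mul0r; apply: le_trans (norm_le_planar_norm 0) => //.
  rewrite -ler_pdivlMl ?normr_gt0 // -normfV.
  by rewrite -{1}(scalerK a0 v); exact: le1.
- move=> v w; apply: planar_norm_lub => P SP; rewrite mulmxDr.
  by apply: le_trans (ler_normD _ _) _; rewrite lerD // planar_norm_ub.
Qed.

Lemma planar_norm_flow i t v : 0 <= t ->
  planar_norm (rotE (cmx R i) l t *m v) <= planar_norm v.
Proof.
move=> t0; apply: planar_norm_lub => P SP; rewrite mulmxA.
by apply: planar_norm_ub; apply: planar_sgrpM => //; exact: planar_sgrp_rotE.
Qed.

Lemma planar_norm_rate i v : fwd_rate planar_norm (cmx R i - l%:M) v 0.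
Proof.
have [E0 D] := rotE_flow l (cmx_sqr R i).
apply: (fwd_rate_flow planar_norm_is_norm (x := fun s => rotE (cmx R i) l s *m v)).
- by rewrite E0 mul1mx.
- by have := D 0 v; rewrite E0 mul1mx.
by exists 1 => // h /andP[h0 _]; rewrite mulr0 addr0; exact/planar_norm_flow/ltW.
Qed.

Lemma planar_norm_orbit k t : 0 <= t -> t <= switch_time m ->
  planar_norm (quarter k (rotE (cmx R true) l t *m switch_pt m)) =
  planar_norm (switch_pt m).
Proof.
apply: (homogeneous_orbit m01 slope) => [a v|i s v s0].
  exact: (is_normZ planar_norm_is_norm).
exact: planar_norm_flow.
Qed.

Lemma planar_extremal_unique (f : 'cV[R]_2 -> R) :
  (forall (a : R) v, f (a *: v) = `|a| * f v) ->
  (forall i (t : R) v, 0 <= t -> f (rotE (cmx R i) l t *m v) <= f v) ->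
  forall v, f v = f (switch_pt m) / planar_norm (switch_pt m) * planar_norm v.
Proof.
move=> fZ ff v; have [r [t [k [t0 tT ->]]]] := orbit_cover l m01 v.
rewrite fZ (is_normZ planar_norm_is_norm) planar_norm_orbit //.
rewrite (homogeneous_orbit m01 slope) // mulrCA divfK // gt_eqF //.
apply: (is_norm_gt0 planar_norm_is_norm); apply/eqP => /colP /(_ 0).
by rewrite !mxE /= => /eqP; rewrite oner_eq0.
Qed.

(** Undoes the shift by [- l]: rate 0 for the shifted matrices becomes rate [l * N v] for the
    original ones. *)
Lemma fwd_rate_addscalar d (N : 'cV[R]_d -> R) (A : 'M[R]_d) (v : 'cV[R]_d) (c a : R) : is_norm N ->
  0 <= a -> fwd_rate N A v c -> fwd_rate N (A + a%:M) v (c + a * N v).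
Proof.
move=> nN a0 fA eps eps0; have [r r0 rP] := fA _ eps0; exists r => // h hr.
have h0 : 0 < h by case/andP: hr.
rewrite mulmxDl mul_scalar_mx scalerDr addrA.
apply: le_trans (is_normD nN _ _) _; rewrite scalerA (is_normZ nN).
by rewrite ger0_norm ?mulr_ge0 ?(ltW h0) //; have := rP h hr; lra.
Qed.

(** [planar_norm] grows at rate at most [l] along every trajectory, and at rate exactly [l] along
    the law of the periodic orbit. *)
Lemma lam_eq : lam R = l.
Proof.
pose N := planar_norm; have nN : is_norm N := planar_norm_is_norm.
have [C C0 NC] := is_norm_le_norm nN.
pose A k := cmx R (~~ odd k).
(* Rate 0, since the matrices are not shifted here; compared with the shifted flow each full arc
   gains a factor [e^(l T)]. *)
pose E k := rotE (A k) 0.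
have T0 := switch_time_gt0 m01; set T := switch_time m in T0.
pose b (k : nat) := k%:R * T.
have fE k : flow (A k) (E k).
  by have := rotE_flow 0 (cmx_sqr R (~~ odd k)); rewrite raddf0 subr0.
have b0 : b 0%N = 0 by rewrite /b mul0r.
have bS k : b k <= b k.+1 by rewrite /b ler_pM2r // ler_nat.
have bE k : b k.+1 - b k = T by rewrite /b -natr1; ring.
have binf t : exists k, t < b k.+1.
  exists (Num.truncn `|t / T|); rewrite /b -ltr_pdivrMr //.
  by apply: le_lt_trans (ler_norm _) _; exact: truncnS_gt.
pose w0 := switch_pt m.
have w00 : w0 != 0.
  by apply/eqP => /colP /(_ 0); rewrite !mxE /= => /eqP; rewrite oner_eq0.
have node k : step_node E b w0 k = expR (l * b k) *: quarter k w0.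
  elim: k => [|k IH]; first by rewrite b0 mulr0 expR0 scale1r.
  rewrite /= bE IH -scalemxAr /E (rotE_rate _ 0 l) -scalemxAl scalerA -expRD.
  rewrite rotE_quarter (orbit_switch m01 slope) quarterSr subr0 -mulrDr.
  by congr (expR (_ * _) *: _); rewrite -(bE k); ring.
pose x := step_traj E w0 binf.
have AAA k : [set mx_of_rows 2 2 [:: [:: 0; -2]; [:: 2^-1; 0]];
         mx_of_rows 2 2 [:: [:: 0; - 2^-1]; [:: 2; 0]]] (A k).
  by rewrite /A /cmx; case: (odd k); [left|right].
have tx : trajectory _ x := step_trajectory w0 AAA fE b0 bS binf.
have Nx t : 0 <= t -> N (x t) = expR (l * t) * N w0.
  move=> t0; have [h1 h2] := step_idx_ltP b0 binf t0.
  set k := step_idx _ _ in h1 h2.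
  rewrite /x (@step_trajE _ _ _ _ _ _ fE b0 bS binf k t h1 (ltW h2)) node.
  rewrite -scalemxAr /E (rotE_rate _ 0 l) -scalemxAl scalerA -expRD subr0 -mulrDr.
  rewrite [b k + _]addrC subrK (is_normZ nN) gtr0_norm ?expR_gt0 //.
  rewrite rotE_quarter /N /w0 planar_norm_orbit //; first by rewrite subr_ge0.
  by rewrite -/T -(bE k) lerD2r ltW.
have x0 : x 0 = w0 by exact: (step_traj0 w0 fE b0 bS binf).
have Nw0 : 0 < N w0 by exact: (is_norm_gt0 nN).
apply: (@lyapunov_exponentE _ _ _ l (2 * C) (N w0 / C) x) => //.
- exact: ltW.
- by rewrite mulr_gt0.
- move=> y ty t t0.
  have := norm_along_trajectory nN ty (ltW l0) (lexx 0) (lexx 0) t0.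
  rewrite !mul0r !addr0 oppr0 expR0 mul1r => h.
  have {}h : N (y t) <= expR (l * t) * N (y 0).
    rewrite -ler_pdivrMl ?expR_gt0 // -expRN [l * t]mulrC; apply: h.
    move=> s B _ AB; have [i ->] : exists i, B = cmx R i.
      by case: AB => ->; [exists false|exists true].
    have := fwd_rate_addscalar nN (ltW l0) (planar_norm_rate i (y s)).
    by rewrite subrK add0r addr0.
  apply: le_trans (enorm_le_norm _) _; rewrite -!mulrA ler_pM2l //.
  apply: le_trans (norm_le_planar_norm _) _; apply: le_trans h _.
  rewrite mulrCA ler_pM2l ?expR_gt0 //; apply: le_trans (NC _) _.
  by rewrite ler_pM2l // norm_le_enorm.
- by rewrite x0.
- by rewrite divr_gt0.
move=> t t0; apply: le_trans (norm_le_enorm _).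
rewrite mulrAC ler_pdivrMr // [`|_| * _]mulrC; apply: le_trans (NC _).
by rewrite Nx // mulrC.
Qed.

End PlanarNorm.

(** * Splitting dimension 4 into an upper and a lower plane *)

Section Blocks.
Variable R : realType.
Implicit Types (v w : 'cV[R]_4) (a b : 'cV[R]_2).

Definition up v : 'cV[R]_2 := @usubmx R 2 2 1 v.
Definition dn v : 'cV[R]_2 := @dsubmx R 2 2 1 v.
Definition pr a b : 'cV[R]_4 := @col_mx R 2 2 1 a b.

Lemma up_pr a b : up (pr a b) = a. Proof. exact: col_mxKu. Qed.
Lemma dn_pr a b : dn (pr a b) = b. Proof. exact: col_mxKd. Qed.
Lemma prE v : v = pr (up v) (dn v). Proof. exact: (esym (@vsubmxK R 2 2 1 v)). Qed.
Lemma upD v w : up (v + w) = up v + up w. Proof. exact: raddfD. Qed.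
Lemma dnD v w : dn (v + w) = dn v + dn w. Proof. exact: raddfD. Qed.
Lemma upZ (c : R) v : up (c *: v) = c *: up v. Proof. exact: linearZ. Qed.
Lemma dnZ (c : R) v : dn (c *: v) = c *: dn v. Proof. exact: linearZ. Qed.
Lemma prD a b a' b' : pr a b + pr a' b' = pr (a + a') (b + b').
Proof. exact: (@add_col_mx _ 2 2 1). Qed.
Lemma prZ (c : R) a b : c *: pr a b = pr (c *: a) (c *: b).
Proof. exact: (@scale_col_mx _ 2 2 1). Qed.
Lemma pr0 : pr 0 0 = 0. Proof. exact: (@col_mx0 _ 2 2 1). Qed.

Definition mxX (i : bool) : 'M[R]_4 := if i then mxX1 R else mxX0 R.

(** This is [X_2 + 1], a complex structure exchanging the two planes, so that [rotE] also gives the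
    flow of [X_2]. *)
Definition mxK : 'M[R]_4 := @block_mx R 2 2 2 2 0 1%:M (- 1%:M) 0.

Lemma mxX_block i : mxX i = @block_mx R 2 2 2 2 (cmx R i - (lam R)%:M) 0 0
  (cmx R i - (lam R + 1)%:M).
Proof.
rewrite /mxX mxX0E mxX1E; move: (lam R) => l.
apply/(@matrixP _ (2 + 2) (2 + 2)) => p q.
case: (@split_ordP 2 2 p) => p' ->; case: (@split_ordP 2 2 q) => q' ->;
  rewrite ?(block_mxEul, block_mxEur, block_mxEdl, block_mxEdr);
  case: p' => -[|[|//]] ?; case: q' => -[|[|//]] ?; case: i;
  rewrite !mxE /= ?mxE /= ?mulr1n ?mulr0n; ring.
Qed.

Lemma mxX_pr i a b : mxX i *m pr a b =
  pr ((cmx R i - (lam R)%:M) *m a) ((cmx R i - (lam R + 1)%:M) *m b).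
Proof.
by rewrite mxX_block /pr (@mul_block_col R 2 2 2 2 1) !mul0mx addr0 add0r.
Qed.

Definition flowX i t : 'M[R]_4 :=
  @block_mx R 2 2 2 2 (rotE (cmx R i) (lam R) t) 0 0 (rotE (cmx R i) (lam R + 1) t).

Lemma flowX_flow i : flow (mxX i) (flowX i).
Proof. by rewrite mxX_block; apply: (@block_flow R 2 2); exact: rotE_flow (cmx_sqr R i). Qed.

Lemma flowX_pr i t a b : flowX i t *m pr a b =
  pr (rotE (cmx R i) (lam R) t *m a) (expR (- t) *: (rotE (cmx R i) (lam R) t *m b)).
Proof.
rewrite /flowX /pr (@mul_block_col R 2 2 2 2 1) !mul0mx addr0 add0r.
rewrite (rotE_rate _ (lam R + 1) (lam R)) -scalemxAl.
by have -> : (lam R - (lam R + 1)) * t = - t by ring.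
Qed.

Lemma mxK_pr a b : mxK *m pr a b = pr b (- a).
Proof.
rewrite /mxK /pr (@mul_block_col R 2 2 2 2 1) !mul0mx mul1mx mulNmx mul1mx.
by rewrite addr0 add0r.
Qed.

Lemma mxK_sqr : mxK *m mxK = - 1%:M.
Proof.
rewrite /mxK (@mulmx_block R 2 2 2 2 2 2) !mul0mx !mulmx0 mulmxN mulNmx !mulmx1.
rewrite !addr0 !add0r (@scalar_mx_block R 2 2) (@opp_block_mx R 2 2 2 2).
by rewrite oppr0.
Qed.

Lemma mxX2_mxK : mxX2 R = mxK - 1%:M.
Proof.
suff -> : mxK = mxX2 R + 1%:M by rewrite addrK.
rewrite mxX2E /mxK; apply/(@matrixP _ (2 + 2) (2 + 2)) => p q.
case: (@split_ordP 2 2 p) => p' ->; case: (@split_ordP 2 2 q) => q' ->;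
  rewrite ?(block_mxEul, block_mxEur, block_mxEdl, block_mxEdr);
  case: p' => -[|[|//]] ?; case: q' => -[|[|//]] ?;
  rewrite !mxE /= ?mulr1n ?mulr0n; ring.
Qed.

Definition flowK t : 'M[R]_4 := rotE mxK 1 t.

Lemma flowK_flow : flow (mxX2 R) flowK.
Proof. by rewrite mxX2_mxK; exact: rotE_flow mxK_sqr. Qed.

Lemma flowK_pr t a b : flowK t *m pr a b =
  expR (- t) *: pr (cos t *: a + sin t *: b) (cos t *: b - sin t *: a).
Proof.
rewrite /flowK /rotE -scalemxAl mulmxDl -!scalemxAl mul1mx mxK_pr mul1r.
by rewrite (prZ (cos t)) (prZ (sin t)) prD scalerN.
Qed.

Lemma hullX_ind (P : 'M[R]_4 -> Prop) : (forall i, P (mxX i)) -> P (mxX2 R) ->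
  (forall A B (s : R), 0 <= s <= 1 -> P A -> P B -> P (s *: A + (1 - s) *: B)) ->
  forall X, hullX R X -> P X.
Proof.
move=> PX P2 Pc X; apply; split.
  move=> A B s; rewrite !inE => PA PB; apply: Pc => //.
  by rewrite ge0 le1.
by move=> A [[->|->]|->]; [exact: (PX false)|exact: (PX true)|].
Qed.

Lemma hullX_mxX i : hullX R (mxX i).
Proof.
by move=> C [_ h]; apply: h; left; case: i; [right|left].
Qed.

Lemma hullX_mxX2 : hullX R (mxX2 R).
Proof. by move=> C [_ h]; apply: h; right. Qed.

End Blocks.

(** * The norm [bar_norm] and the decay of the lower component *)

Section BarabanovNorm.
Variables (R : realType) (m : R).
Hypothesis m01 : 0 < m < 1.
Hypothesis lE : lam R = 5 / 2 * m / (1 - m ^+ 2).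
Hypothesis slope : 2 * lam R * (atan (2 * m)^-1 + atan (m / 2)) =
  ln (4 + m ^+ 2) - ln (1 + 4 * m ^+ 2).
Implicit Types (v w : 'cV[R]_4) (a b : 'cV[R]_2) (t : R).

Let nB := planar_norm (lam R).
Let nBN : is_norm nB := planar_norm_is_norm m01 lE slope.
Let nB_flow i t a : 0 <= t -> nB (rotE (cmx R i) (lam R) t *m a) <= nB a :=
  @planar_norm_flow _ _ _ m01 lE slope i t a.

(** The value of [nB] at the upper component after following [X_2] for time [t]. *)
Definition bar_fun v t := expR (- t) * nB (cos t *: up v + sin t *: dn v).

Definition bar_norm v := sup [set bar_fun v t | t in `[0, pi]].

Lemma bar_fun_continuous v : continuous (bar_fun v).
Proof.
move=> t; apply: cvgM.
  apply: (continuous_comp (f := -%R) (g := @expR R)).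
    exact: opp_continuous.
  exact: continuous_expR.
apply/cvgrPdist_le => e e0.
pose K := nB (up v) + nB (dn v) + 1.
have K0 : 0 < K by rewrite ltr_wpDl // addr_ge0 // (is_norm_ge0 nBN).
have cc := (cvgrPdist_le _ _).1 (@continuous_cos R t) (e / K) (divr_gt0 e0 K0).
have cs := (cvgrPdist_le _ _).1 (@continuous_sin R t) (e / K) (divr_gt0 e0 K0).
near=> s; apply: le_trans (is_norm_distB nBN _ _) _.
have -> : cos t *: up v + sin t *: dn v - (cos s *: up v + sin s *: dn v) =
   (cos t - cos s) *: up v + (sin t - sin s) *: dn v.
  by rewrite !scalerBl opprD addrACA.
apply: le_trans (is_normD nBN _ _) _; rewrite !(is_normZ nBN).
apply: (@le_trans _ _ (e / K * nB (up v) + e / K * nB (dn v))).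
  have c1 : `|cos t - cos s| <= e / K by near: s; exact: cc.
  have c2 : `|sin t - sin s| <= e / K by near: s; exact: cs.
  by apply: lerD; apply: ler_wpM2r => //; exact: (is_norm_ge0 nBN).
rewrite -mulrDr mulrAC ler_pdivrMr // ler_pM2l // /K; lra.
Unshelve. all: by end_near. Qed.

Lemma bar_norm_attained v : exists2 t, 0 <= t <= pi &
  bar_norm v = bar_fun v t /\ forall s, 0 <= s <= pi -> bar_fun v s <= bar_norm v.
Proof.
have [t] := EVT_max (@pi_ge0 R) (continuous_subspaceT (@bar_fun_continuous v)).
rewrite in_itv /= => tpi tmax; exists t => //.
have h : bar_norm v = bar_fun v t.
  apply/eqP; rewrite eq_le; apply/andP; split.
    apply: ge_sup => [|_ [s spi <-]]; first by exists (bar_fun v t), t.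
    exact: tmax.
  apply: sup_upper_bound; last by exists t.
  split; first by exists (bar_fun v t), t.
  by exists (bar_fun v t) => _ [s spi <-]; exact: tmax.
by split => // s spi; rewrite h; apply: tmax; rewrite in_itv.
Qed.

Lemma bar_fun_le v s : 0 <= s <= pi -> bar_fun v s <= bar_norm v.
Proof. by have [t _ [_]] := bar_norm_attained v; apply. Qed.

Lemma up_le_bar_norm v : nB (up v) <= bar_norm v.
Proof.
have := @bar_fun_le v 0; rewrite /bar_fun oppr0 expR0 cos0 sin0 scale0r addr0.
by rewrite scale1r mul1r lexx pi_ge0; apply.
Qed.

Lemma dn_le_bar_norm v : expR (- (pi / 2)) * nB (dn v) <= bar_norm v.
Proof.
have := @bar_fun_le v (pi / 2); rewrite /bar_fun cos_pihalf sin_pihalf scale0r.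
rewrite add0r scale1r; apply; have := @pi_ge2 R; lra.
Qed.

Lemma bar_norm_is_norm : is_norm bar_norm.
Proof.
split.
- by move=> v; apply: le_trans (up_le_bar_norm v); exact: is_norm_ge0 nBN _.
- move=> v v0; have h1 := up_le_bar_norm v; have h2 := dn_le_bar_norm v.
  rewrite v0 in h1 h2; rewrite pmulr_rle0 ?expR_gt0 // in h2.
  have u0 : up v = 0.
    by apply: (is_norm_eq0 nBN); apply/eqP; rewrite eq_le h1 (is_norm_ge0 nBN).
  have d0 : dn v = 0.
    by apply: (is_norm_eq0 nBN); apply/eqP; rewrite eq_le h2 (is_norm_ge0 nBN).
  by rewrite [v]prE u0 d0 pr0.
- have fZ (c : R) v t : bar_fun (c *: v) t = `|c| * bar_fun v t.
    rewrite /bar_fun upZ dnZ !scalerA ![_ * c]mulrC -!scalerA -scalerDr.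
    by rewrite (is_normZ nBN) mulrCA.
  move=> c v; have [t tpi [tE tmax]] := bar_norm_attained (c *: v).
  have [s spi [sE smax]] := bar_norm_attained v.
  apply/eqP; rewrite eq_le tE fZ ler_wpM2l //=; last exact: smax.
  by rewrite sE -!fZ -tE; exact: tmax.
- move=> v w; have [t tpi [-> _]] := bar_norm_attained (v + w).
  apply: le_trans (lerD (bar_fun_le v tpi) (bar_fun_le w tpi)).
  rewrite /bar_fun -mulrDr ler_pM2l ?expR_gt0 // upD dnD !scalerDr addrACA.
  exact: is_normD nBN _ _.
Qed.

(** The damping of [X_2] outweighs what its rotation can gain, because
    [|cos t| + |sin t| <= 1 + t <= e^t]. *)
Lemma bar_norm_flat v : nB (dn v) <= nB (up v) -> bar_norm v = nB (up v).
Proof.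
move=> h; apply/eqP; rewrite eq_le up_le_bar_norm andbT.
have [t /andP[t0 _] [-> _]] := bar_norm_attained v.
rewrite /bar_fun expRN mulrC ler_pdivrMr ?expR_gt0 //.
apply: le_trans (is_normD nBN _ _) _; rewrite !(is_normZ nBN).
have st : `|sin t| <= t.
  have [|c _] := @MVT_segment R sin cos 0 t t0 (fun x _ => is_derive_sin x).
    by apply: continuous_subspaceT => s; exact: continuous_sin.
  rewrite sin0 !subr0 => ->; rewrite normrM (ger0_norm t0) ler_piMl //.
  by rewrite ler_norml cos_geN1 cos_le1.
have ct : `|cos t| <= 1 by rewrite ler_norml cos_geN1 cos_le1.
have n0 := is_norm_ge0 nBN (up v); have n1 := is_norm_ge0 nBN (dn v).
have h1 := ler_pM (normr_ge0 _) n1 st h.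
have h2 := ler_wpM2r n0 ct; have h3 := ler_wpM2l n0 (expR_ge1Dx t).
by lra.
Qed.

(** The extra damping [e] of the lower plane replaces [cos t a + sin t b] by its convex combination
    with [cos t a]; after the factor [e^-t], both have [nB] at most [bar_norm v]. *)
Lemma bar_norm_flowX i h v : 0 <= h -> bar_norm (flowX i h *m v) <= bar_norm v.
Proof.
move=> h0; have [t tpi [-> _]] := bar_norm_attained (flowX i h *m v).
rewrite [v]prE flowX_pr /bar_fun up_pr dn_pr -prE.
set a := up v; set b := dn v; set e := expR (- h).
have e0 : 0 < e := expR_gt0 _.
have e1 : e <= 1 by rewrite -expR0 ler_expR oppr_le0.
have -> : cos t *: (rotE (cmx R i) (lam R) h *m a) +
    sin t *: (e *: (rotE (cmx R i) (lam R) h *m b)) =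
  rotE (cmx R i) (lam R) h *m ((1 - e) *: (cos t *: a) + e *: (cos t *: a + sin t *: b)).
  rewrite mulmxDr -!scalemxAr mulmxDr -!scalemxAr.
  move: (rotE _ _ _ *m a) (rotE _ _ _ *m b) => a' b'.
  by apply/colP => j; rewrite !mxE; ring.
apply: (@le_trans _ _ (expR (- t) * ((1 - e) * nB a + e * nB (cos t *: a + sin t *: b)))).
  rewrite ler_pM2l ?expR_gt0 //; apply: le_trans (nB_flow _ _ h0) _.
  apply: le_trans (is_normD nBN _ _) _; rewrite !(is_normZ nBN).
  rewrite (ger0_norm (x := 1 - e)) ?subr_ge0 // (gtr0_norm e0) lerD2r.
  rewrite ler_wpM2l ?subr_ge0 // ler_piMl ?(is_norm_ge0 nBN) //.
  by rewrite ler_norml cos_geN1 cos_le1.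
have h1 := bar_fun_le v tpi; have h2 := up_le_bar_norm v.
rewrite /bar_fun -/a -/b in h1; rewrite -/a in h2.
have t1 : expR (- t) <= 1.
  by rewrite -expR0 ler_expR oppr_le0; case/andP: tpi.
have h3 : expR (- t) * nB a <= nB a by rewrite ler_piMl ?(is_norm_ge0 nBN).
have e1' : 0 <= 1 - e by rewrite subr_ge0.
have := ler_wpM2l e1' (le_trans h3 h2); have := ler_wpM2l (ltW e0) h1.
lra.
Qed.

(** The flow shifts the parameter by [h]. Beyond [pi], a half turn is a sign change with factor
    [e^-pi], so the interval from 0 to [pi] already contains the maximum. *)
Lemma bar_norm_flowK h v : 0 <= h <= pi -> bar_norm (flowK h *m v) <= bar_norm v.
Proof.
move=> /andP[h0 hpi].
have [t /andP[t0 tpi] [-> _]] := bar_norm_attained (flowK h *m v).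
have -> : bar_fun (flowK h *m v) t = bar_fun v (t + h).
  rewrite /bar_fun {1 2}[v]prE flowK_pr upZ dnZ up_pr dn_pr.
  set a := up v; set b := dn v.
  have -> : cos t *: (expR (- h) *: (cos h *: a + sin h *: b)) +
      sin t *: (expR (- h) *: (cos h *: b - sin h *: a)) =
      expR (- h) *: (cos (t + h) *: a + sin (t + h) *: b).
    by apply/colP => i; rewrite cosD sinD !mxE; ring.
  by rewrite (is_normZ nBN) gtr0_norm ?expR_gt0 // mulrA -expRD -opprD.
have [thpi|thpi] := leP (t + h) pi; first by apply: bar_fun_le; rewrite addr_ge0.
have -> : bar_fun v (t + h) = expR (- pi) * bar_fun v (t + h - pi).
  have -> : t + h = (t + h - pi) + pi by rewrite subrK.
  rewrite {1}/bar_fun cosDpi sinDpi !scaleNr -opprD (is_normN nBN) opprD expRD.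
  by rewrite addrK /bar_fun mulrA [expR (- pi) * _]mulrC.
have hs : 0 <= t + h - pi <= pi by apply/andP; split; lra.
apply: le_trans (bar_fun_le v hs); rewrite ler_piMl //.
  by rewrite mulr_ge0 ?expR_ge0 // (is_norm_ge0 nBN).
by rewrite -expR0 ler_expR oppr_le0 pi_ge0.
Qed.

Lemma bar_norm_rate X v : hullX R X -> fwd_rate bar_norm X v 0.
Proof.
apply: (hullX_ind (P := fun X => fwd_rate bar_norm X v 0)) => [i||A B s s01 hA hB].
- have [E0 D] := flowX_flow R i.
  apply: (fwd_rate_flow bar_norm_is_norm (x := fun s => flowX i s *m v)).
  + by rewrite E0 mul1mx.
  + by have := D 0 v; rewrite E0 mul1mx.
  by exists 1 => // h /andP[h0 _]; rewrite mulr0 addr0; exact/bar_norm_flowX/ltW.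
- have [E0 D] := flowK_flow R.
  apply: (fwd_rate_flow bar_norm_is_norm (x := fun s => flowK s *m v)).
  + by rewrite E0 mul1mx.
  + by have := D 0 v; rewrite E0 mul1mx.
  exists pi => [|h /andP[h0 hp]]; first exact: pi_gt0.
  by rewrite mulr0 addr0; apply: bar_norm_flowK; rewrite !ltW.
- exact: (fwd_rate_conv bar_norm_is_norm).
Qed.

Lemma bar_norm_trajectory x s t : trajectory (hullX R) x -> 0 <= s -> s <= t ->
  bar_norm (x t) <= bar_norm (x s).
Proof.
move=> tx s0 st.
have := norm_along_trajectory0 bar_norm_is_norm tx (lexx 0) s0 st.
rewrite !mul0r !addr0; apply => r A _ XA.
by rewrite oppr0; exact: bar_norm_rate.
Qed.

(* [drift_norm] decreases at rate at least [nB (dn v)], which forces the lower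
   component of any trajectory to come arbitrarily close to [0]. *)
Definition drift_norm v :=
  3 / 2 * (nB (up v) + nB (dn v)) + (nB (up v + dn v) + nB (up v - dn v)).

Lemma drift_norm_is_norm : is_norm drift_norm.
Proof.
have h0 := is_norm_ge0 nBN; split.
- by move=> v; rewrite addr_ge0 ?mulr_ge0 ?addr_ge0.
- move=> v; rewrite /drift_norm => e.
  have := h0 (up v); have := h0 (dn v).
  have := h0 (up v + dn v); have := h0 (up v - dn v) => h1 h2 h3 h4.
  have u0 : up v = 0 by apply: (is_norm_eq0 nBN); lra.
  have d0 : dn v = 0 by apply: (is_norm_eq0 nBN); lra.
  by rewrite [v]prE u0 d0 pr0.
- move=> c v; rewrite /drift_norm upZ dnZ -scalerDr -scalerBr !(is_normZ nBN).
  by ring.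
- move=> v w; rewrite /drift_norm upD dnD.
  have h1 := is_normD nBN (up v) (up w); have h2 := is_normD nBN (dn v) (dn w).
  have h3 := is_normD nBN (up v + dn v) (up w + dn w).
  have h4 := is_normD nBN (up v - dn v) (up w - dn w).
  rewrite (addrACA (up v) (up w)) opprD (addrACA (up v) (up w)); lra.
Qed.

(** Under [X_2] the pairs [a, b] and [a + b, a - b] feed each other: with a weight [c] on the first
    pair, its contribution changes at rate at most [2 - 2 c] and that of the second at most [c - 2].
    For [c = 3 / 2] these are [-1] and [- 1 / 2]. Under [X_0] and [X_1] the second pair does not
    grow, by convexity, and the damping of [b] gives the decrease. *)
Lemma drift_norm_rate X v : hullX R X -> fwd_rate drift_norm X v (- nB (dn v)).
Proof.
have h0 := is_norm_ge0 nBN.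
apply: (hullX_ind (P := fun X => fwd_rate drift_norm X v (- nB (dn v)))) =>
  [i||A B s s01 hA hB].
- have [E0 D] := flowX_flow R i.
  apply: (fwd_rate_flow drift_norm_is_norm (x := fun s => flowX i s *m v)).
  + by rewrite E0 mul1mx.
  + by have := D 0 v; rewrite E0 mul1mx.
  (* For [h < 1 / 2] one has [1 - e >= h / (1 + h) >= 2 h / 3], so that [3 / 2 * nB b] drops by at
     least [h * nB b]. *)
  exists (1 / 2) => // h /andP[hp h2].
  rewrite /drift_norm {1 2 3 4 5 6}[v]prE flowX_pr up_pr dn_pr.
  set a := up v; set b := dn v; set e := expR (- h).
  have e0 : 0 < e := expR_gt0 _.
  have e1 : e <= 1 by rewrite -expR0 ler_expR oppr_le0 ltW.
  have e2 : e * (1 + h) <= 1.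
    rewrite /e expRN mulrC ler_pdivrMr ?expR_gt0 // mul1r; exact: expR_ge1Dx.
  have k1 := nB_flow i a (ltW hp); have k2 := nB_flow i b (ltW hp).
  have k3 := nB_flow i (a + b) (ltW hp); have k4 := nB_flow i (a - b) (ltW hp).
  move: k1 k2 k3 k4; rewrite mulmxDr mulmxBr.
  set a' := rotE _ _ _ *m a; set b' := rotE _ _ _ *m b => k1 k2 k3 k4.
  rewrite (is_normZ nBN) gtr0_norm //.
  have -> : a' + e *: b' = ((1 + e) / 2) *: (a' + b') + ((1 - e) / 2) *: (a' - b').
    by apply/colP => j; rewrite !mxE; field.
  have -> : a' - e *: b' = ((1 - e) / 2) *: (a' + b') + ((1 + e) / 2) *: (a' - b').
    by apply/colP => j; rewrite !mxE; field.
  have j1 := is_normD nBN (((1 + e) / 2) *: (a' + b')) (((1 - e) / 2) *: (a' - b')).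
  have j2 := is_normD nBN (((1 - e) / 2) *: (a' + b')) (((1 + e) / 2) *: (a' - b')).
  have q1 : 0 <= (1 + e) / 2 by rewrite divr_ge0 // addr_ge0 // ltW.
  have q2 : 0 <= (1 - e) / 2 by rewrite divr_ge0 // subr_ge0.
  rewrite !(is_normZ nBN) !(ger0_norm q1) !(ger0_norm q2) in j1 j2.
  have eb := ler_wpM2l (ltW e0) k2.
  have : (3 / 2 * (1 - e) - h) * nB b >= 0.
    by apply: mulr_ge0 => //; nra.
  lra.
- move=> eps eps0; exists (1 / 2) => // h /andP[hp h2].
  have g1 : 0 <= 1 - 2 * h by lra.
  have g2 : 0 <= 2 * h by lra.
  rewrite mxX2_mxK mulmxBl mul1mx.
  have -> : v + h *: (mxK R *m v - v) =
    pr (up v + h *: (dn v - up v)) (dn v - h *: (up v + dn v)).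
    move: (up v) (dn v) (prE v) => a b ->; rewrite mxK_pr.
    rewrite -(scaleN1r (pr a b)) (prZ (- 1)) prD (prZ h) prD.
    by congr pr; apply/colP => j; rewrite !mxE; ring.
  rewrite /drift_norm up_pr dn_pr.
  set a := up v; set b := dn v.
  have -> : a + h *: (b - a) = (1 - 2 * h) *: a + h *: (a + b).
    by apply/colP => j; rewrite !mxE; ring.
  have -> : b - h *: (a + b) = (1 - 2 * h) *: b + h *: - (a - b).
    by apply/colP => j; rewrite !mxE; ring.
  have -> : (1 - 2 * h) *: a + h *: (a + b) + ((1 - 2 * h) *: b + h *: - (a - b)) =
     (1 - 2 * h) *: (a + b) + (2 * h) *: b.
    by apply/colP => j; rewrite !mxE; ring.
  have -> : (1 - 2 * h) *: a + h *: (a + b) - ((1 - 2 * h) *: b + h *: - (a - b)) =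
     (1 - 2 * h) *: (a - b) + (2 * h) *: a.
    by apply/colP => j; rewrite !mxE; ring.
  have j1 := is_normD nBN ((1 - 2 * h) *: a) (h *: (a + b)).
  have j2 := is_normD nBN ((1 - 2 * h) *: b) (h *: - (a - b)).
  have j3 := is_normD nBN ((1 - 2 * h) *: (a + b)) ((2 * h) *: b).
  have j4 := is_normD nBN ((1 - 2 * h) *: (a - b)) ((2 * h) *: a).
  rewrite !(is_normZ nBN) !(ger0_norm g1) ?(is_normN nBN) in j1 j2 j3 j4.
  rewrite ?(ger0_norm g2) ?(gtr0_norm hp) in j1 j2 j3 j4.
  have := h0 a; have := h0 b; have := h0 (a + b); have := h0 (a - b) => p1 p2 p3 p4.
  have := mulr_ge0 (ltW hp) p1; have := mulr_ge0 (ltW hp) p2.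
  have := mulr_ge0 (ltW hp) p3; have := mulr_ge0 (ltW hp) p4.
  have := mulr_gt0 eps0 hp; lra.
- exact: (fwd_rate_conv drift_norm_is_norm).
Qed.

Lemma dn_liminf x : trajectory (hullX R) x -> forall eps : R, 0 < eps ->
  exists2 t : R, 0 <= t & nB (dn (x t)) < eps.
Proof.
move=> tx eps eps0; apply: contrapT => h.
have {}h t : 0 <= t -> eps <= nB (dn (x t)).
  by move=> t0; rewrite leNgt; apply/negP => k; apply: h; exists t.
have D0 := is_norm_ge0 drift_norm_is_norm.
pose b := (drift_norm (x 0) + 1) / eps.
have b0 : 0 <= b by rewrite divr_ge0 ?(ltW eps0) // addr_ge0 // D0.
have : drift_norm (x b) + eps * b <= drift_norm (x 0) + eps * 0.
  apply: (norm_along_trajectory0 drift_norm_is_norm tx (ltW eps0) (lexx 0) b0).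
  move=> t A t0 XA e e0; have [r r0 rP] := drift_norm_rate (x t) XA e0.
  exists r => // s sr; apply: le_trans (rP s sr) _.
  rewrite lerD2r lerD2l ler_wpM2l ?lerN2 ?h //.
  by case/andP: sr => /ltW.
rewrite mulr0 addr0.
have -> : eps * b = drift_norm (x 0) + 1 by rewrite /b mulrC divfK ?gt_eqF.
by have := D0 (x b); lra.
Qed.

End BarabanovNorm.

(** * Optimal trajectories, marginal stability and uniqueness *)

Section BarabanovUniqueness.
Variables (R : realType) (m : R).
Hypothesis m01 : 0 < m < 1.
Hypothesis lE : lam R = 5 / 2 * m / (1 - m ^+ 2).
Hypothesis slope : 2 * lam R * (atan (2 * m)^-1 + atan (m / 2)) =
  ln (4 + m ^+ 2) - ln (1 + 4 * m ^+ 2).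
Implicit Types (u v w : 'cV[R]_4) (a b : 'cV[R]_2) (t : R).

Let nB := planar_norm (lam R).
Let nBN : is_norm nB := planar_norm_is_norm m01 lE slope.
Let nB_flow i t a : 0 <= t -> nB (rotE (cmx R i) (lam R) t *m a) <= nB a :=
  @planar_norm_flow _ _ _ m01 lE slope i t a.
Let bar : 'cV[R]_4 -> R := @bar_norm R.
Let barN : is_norm bar := bar_norm_is_norm m01 lE slope.

(* Follow [X_2] up to time [t0], then the periodic optimal law for the upper
   component. *)
Lemma optimal_trajectory u t0 : 0 <= t0 -> exists x,
  [/\ trajectory (hullX R) x, x 0 = u,
      forall t, t0 <= t -> nB (up (x t)) = bar_fun u t0 &
      exists2 K : R, 0 <= K &
        forall t, t0 <= t -> nB (dn (x t)) <= K * expR (- (t - t0))].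
Proof.
move=> t00; pose v := flowK t0 *m u; pose w0 := switch_pt m.
pose T := switch_time m; have T0 : 0 < T := switch_time_gt0 m01.
(* After the [X_2] stage the upper component sits at phase [tau] of an arc of the periodic orbit, so
   the next stage lasts [T - tau] and all later ones [T]; [th] records the phase at which a stage
   starts. *)
have [r [tau [k [tau0 tauT vE]]]] := orbit_cover (lam R) m01 (up v).
rewrite -/T in tauT; rewrite -/w0 in vE.
pose A j := if j is j'.+1 then mxX R (~~ odd (k + j')) else mxX2 R.
pose E j : R -> 'M[R]_4 := if j is j'.+1 then flowX (~~ odd (k + j')) else @flowK R.
pose b (j : nat) := match j with 0%N => 0 | 1%N => t0
  | j'.+2 => t0 + (T - tau) + j'%:R * T end.
pose th (j : nat) := if j is 0%N then tau else 0.
have fE j : flow (A j) (E j).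
  by case: j => [|j]; [exact: flowK_flow|exact: flowX_flow].
have AAA j : hullX R (A j).
  by case: j => [|j]; [exact: hullX_mxX2|exact: hullX_mxX].
have bE j : b j.+2 - b j.+1 = T - th j.
  by case: j => [|j] /=; rewrite -?natr1; ring.
have th0 j : 0 <= th j <= T by case: j => [|j] /=; rewrite ?tau0 ?tauT ?lexx ?(ltW T0).
have bS j : b j <= b j.+1.
  case: j => [//|j]; rewrite -subr_ge0 bE subr_ge0.
  by case/andP: (th0 j).
have b0 : b 0%N = 0 by [].
have binf t : exists j, t < b j.+1.
  exists (Num.truncn (`|t| / T)).+2; rewrite /=.
  have h1 : `|t| < (Num.truncn (`|t| / T)).+1%:R * T.
    by rewrite -ltr_pdivrMr //; exact: truncnS_gt.
  by have := ler_norm t; rewrite -subr_ge0 in tauT; lra.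
have nodeP j : up (step_node E b u j.+1) =
    r *: quarter (k + j) (rotE (cmx R true) (lam R) (th j) *m w0) /\
  nB (dn (step_node E b u j.+1)) <= expR (- (b j.+1 - t0)) * nB (dn v).
  elim: j => [|j [IH1 IH2]].
    have -> : step_node E b u 1 = v by rewrite /= subr0.
    by rewrite addn0 -vE subrr oppr0 expR0 mul1r.
  set n := step_node E b u j.+1 in IH1 IH2.
  have -> : step_node E b u j.+2 = flowX (~~ odd (k + j)) (T - th j) *m n.
    by rewrite -bE.
  have Th : 0 <= T - th j by rewrite subr_ge0; case/andP: (th0 j).
  rewrite [n]prE flowX_pr up_pr dn_pr IH1; split.
    rewrite -scalemxAr rotE_quarter mulmxA rotED ?cmx_sqr // subrK.
    by rewrite (orbit_switch m01 slope) quarterSr addnS /= rotE0 mul1mx.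
  rewrite (is_normZ nBN) gtr0_norm ?expR_gt0 //.
  have -> : - (b j.+2 - t0) = - (T - th j) + - (b j.+1 - t0).
    by rewrite -bE; ring.
  rewrite expRD -mulrA ler_pM2l ?expR_gt0 //.
  by apply: le_trans IH2; exact: nB_flow.
pose x := step_traj E u binf.
have xE t : t0 <= t -> exists j, [/\ b j.+1 <= t, t <= b j.+2 &
    x t = flowX (~~ odd (k + j)) (t - b j.+1) *m step_node E b u j.+1].
  move=> tt; have t0' : 0 <= t := le_trans t00 tt.
  have [h1 h2] := step_idx_ltP b0 binf t0'.
  have := @step_trajE _ _ _ _ _ _ fE b0 bS binf (step_idx binf t) t h1 (ltW h2).
  case: (step_idx binf t) h1 h2 => [|j] h1 h2 xt.
    by move: h2; rewrite /= ltNge tt.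
  exists j; split; [exact: h1|exact: (ltW h2)|exact: xt].
exists x; split.
- exact: (step_trajectory u AAA fE b0 bS binf).
- exact: (step_traj0 u fE b0 bS binf).
- move=> t /xE [j [h1 h2 ->]]; have [n1 _] := nodeP j.
  rewrite [step_node E b u j.+1]prE flowX_pr up_pr n1 -scalemxAr rotE_quarter.
  rewrite mulmxA rotED ?cmx_sqr // (is_normZ nBN) /nB /w0.
  have hh := bE j; have [/andP[q1 q2]] := th0 j.
  have s1 : 0 <= t - b j.+1 + th j by rewrite addr_ge0 // subr_ge0.
  have s2 : t - b j.+1 + th j <= switch_time m by rewrite -/T; lra.
  rewrite (planar_norm_orbit m01 lE slope) //.
  have : nB (up v) = `|r| * planar_norm (lam R) (switch_pt m).
    by rewrite vE (is_normZ nBN) /nB /w0 (planar_norm_orbit m01 lE slope).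
  move=> <-; rewrite /v {1}[u]prE flowK_pr upZ up_pr (is_normZ nBN).
  by rewrite gtr0_norm ?expR_gt0.
- exists (nB (dn v)); first exact: (is_norm_ge0 nBN).
  move=> t /xE [j [h1 h2 ->]]; have [_ n2] := nodeP j.
  rewrite [step_node E b u j.+1]prE flowX_pr dn_pr (is_normZ nBN).
  rewrite gtr0_norm ?expR_gt0 //.
  have -> : - (t - t0) = - (t - b j.+1) + - (b j.+1 - t0) by ring.
  rewrite expRD mulrCA ler_pM2l ?expR_gt0 // mulrC; apply: le_trans n2.
  by apply: nB_flow; rewrite subr_ge0.
Qed.

(** With [t0] the maximizing time, the upper component alone keeps [bar] at least [bar u] from [t0]
    on; monotonicity extends this to earlier times and gives the opposite bound. *)
Lemma barabanov_trajectory u : exists x,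
  [/\ trajectory (hullX R) x, x 0 = u & forall t, 0 <= t -> bar (x t) = bar u].
Proof.
have [t0 /andP[t00 _] [uE _]] := bar_norm_attained m01 lE slope u.
have [x [tx x0 xup _]] := optimal_trajectory u t00.
exists x; split; [exact: tx|exact: x0|move=> t t1].
have le0 : bar (x t) <= bar u.
  by rewrite -x0; apply: (bar_norm_trajectory m01 lE slope).
apply/eqP; rewrite eq_le le0 andTb.
have le1 s : t0 <= s -> bar u <= bar (x s).
  move=> ts; rewrite /bar uE -(xup s ts).
  exact: (up_le_bar_norm m01 lE slope).
have [/le1//|/ltW tt0] := leP t0 t.
apply: le_trans (le1 t0 (lexx _)) _.
exact: (bar_norm_trajectory m01 lE slope).
Qed.

Lemma norm_le_bar : exists2 C : R, 0 < C & forall v, enorm v <= C * bar v.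
Proof.
(* The dimension 4 compares [enorm] with the sup norm; [e^(pi / 2)] is the time a lower component
   needs to become an upper one. *)
exists (4 * expR (pi / 2)) => [|v]; first by rewrite mulr_gt0 ?expR_gt0.
have e1 : 1 <= expR (pi / 2 : R).
  by rewrite -expR0 ler_expR divr_ge0 // pi_ge0.
have h1 := up_le_bar_norm m01 lE slope v.
have h2 := dn_le_bar_norm m01 lE slope v.
have h3 := norm_le_planar_norm m01 lE slope (up v).
have h4 := norm_le_planar_norm m01 lE slope (dn v).
rewrite expRN -ler_pdivlMl ?invr_gt0 ?expR_gt0 // invrK in h2.
have b0 := is_norm_ge0 barN v.
apply: le_trans (enorm_le_norm _) _; rewrite -mulrA ler_pM2l //.
rewrite [leLHS]/Num.Def.normr /= mx_normrE; apply: bigmax_le.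
  by rewrite mulr_ge0 ?expR_ge0.
move=> [i j] _ /=; rewrite (ord1 j) {1}[v]prE.
case: (@split_ordP 2 2 i) => i' ->.
  have -> : pr (up v) (dn v) (lshift 2 i') 0 = up v i' 0 by exact: (@col_mxEu _ 2 2 1).
  apply: le_trans (coord_le_norm _ _) _; apply: le_trans h3 _.
  by apply: le_trans h1 _; rewrite ler_peMl.
have -> : pr (up v) (dn v) (rshift 2 i') 0 = dn v i' 0 by exact: (@col_mxEd _ 2 2 1).
by apply: le_trans (coord_le_norm _ _) _; apply: le_trans h4 _.
Qed.

Lemma bounded_trajectories : exists2 C : R, 0 < C &
  forall x, trajectory (hullX R) x -> forall t, 0 <= t ->
  enorm (x t) <= C * enorm (x 0).
Proof.
have [C C0 nb] := norm_le_bar; have [D D0 bn] := is_norm_le_norm barN.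
exists (C * D) => [|x tx t t0]; first exact: mulr_gt0.
apply: le_trans (nb _) _; rewrite -mulrA ler_pM2l //.
apply: le_trans (bar_norm_trajectory m01 lE slope tx (lexx 0) t0) _.
by apply: le_trans (bn _) _; rewrite ler_pM2l // norm_le_enorm.
Qed.

Lemma persistent_trajectory : exists x, exists2 c : R, 0 < c &
  [/\ trajectory (hullX R) x, x 0 != 0 & forall t, 0 <= t -> c <= enorm (x t)].
Proof.
pose u : 'cV[R]_4 := const_mx 1.
have u0 : u != 0.
  by apply/eqP => /colP /(_ 0) /eqP; rewrite !mxE oner_eq0.
have [x [tx x0 xb]] := barabanov_trajectory u.
have [D D0 bn] := is_norm_le_norm barN.
exists x, (bar u / D); first by rewrite divr_gt0 // (is_norm_gt0 barN).
split; rewrite ?x0 // => t t0; rewrite ler_pdivrMr // -(xb t t0) mulrC.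
by apply: le_trans (bn _) _; rewrite ler_pM2l // norm_le_enorm.
Qed.

Lemma lyapunov_hullX : lyapunov_exponent (hullX R) = 0.
Proof.
have [C C0 ub] := bounded_trajectories.
have [x [c c0 [tx x0 xc]]] := persistent_trajectory.
apply: (lyapunov_exponentE (lexx 0) C0 _ tx x0 c0) => [y ty t t0|t t0].
  by rewrite mul0r expR0 mulr1; exact: ub.
by rewrite mul0r expR0 mulr1; exact: xc.
Qed.

Lemma marginally_stable_hullX : marginally_stable (hullX R).
Proof.
have [C C0 ub] := bounded_trajectories; split; last by exists C.
- move=> [D [k [D0 k0 h]]]; have [x [c c0 [tx x0 xc]]] := persistent_trajectory.
  have e0 := enorm_gt0 x0; have De : 0 < D * enorm (x 0) by exact: mulr_gt0.
  (* At this time [c * (1 + k * t)] exceeds [D * enorm (x 0)], which contradicts exponential decay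
     through [1 + s <= e^s]. *)
  pose t := D * enorm (x 0) / (c * k).
  have t0 : 0 <= t by rewrite divr_ge0 ?mulr_ge0 // ltW.
  have := le_trans (xc t t0) (h x tx t t0).
  rewrite expRN mulrAC ler_pdivlMr ?expR_gt0 // => h1.
  have kt : k * t = D * enorm (x 0) / c by rewrite /t; field; rewrite !gt_eqF.
  have := le_trans (ler_wpM2l (ltW c0) (expR_ge1Dx (k * t))) h1.
  by rewrite kt mulrDr mulr1 mulrCA divff ?gt_eqF // mulr1; lra.
- move=> [x [D [k [tx D0 k0 h]]]].
  have [_] := h 0 (lexx 0); rewrite mulr0 expR0 mulr1 pmulr_rgt0 // => e0.
  pose t := C / (D * k).
  have t0 : 0 <= t by rewrite divr_ge0 ?mulr_ge0 // ltW.
  have [h1 _] := h t t0; have := le_trans h1 (ub x tx t t0).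
  rewrite ler_pM2r // => h2.
  have kt : k * t = C / D by rewrite /t; field; rewrite !gt_eqF.
  have := le_trans (ler_wpM2l (ltW D0) (expR_ge1Dx (k * t))) h2.
  by rewrite kt mulrDr mulr1 mulrCA divff ?gt_eqF // mulr1; lra.
Qed.

Lemma bar_barabanov : barabanov_norm (hullX R) bar.
Proof.
rewrite /barabanov_norm /extremal_norm lyapunov_hullX; split; first split.
- exact: barN.
- move=> x tx s t s0 st; rewrite !mulr0 oppr0 expR0 !mul1r.
  exact: (bar_norm_trajectory m01 lE slope).
move=> u; have [x [tx x0 xb]] := barabanov_trajectory u.
exists x => //; split=> //; exists (bar u) => t t0.
by rewrite mulr0 oppr0 expR0 mul1r xb.
Qed.

Section Unique.
Variable N : 'cV[R]_4 -> R.
Hypothesis bN : barabanov_norm (hullX R) N.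

Let nN : is_norm N. Proof. by case: bN => -[]. Qed.

Let N_traj x s t : trajectory (hullX R) x -> 0 <= s -> s <= t -> N (x t) <= N (x s).
Proof.
case: bN => -[_ h] _ tx s0 st; have := h x tx s t s0 st.
by rewrite lyapunov_hullX !mulr0 oppr0 expR0 !mul1r.
Qed.

Let N_flowX i h v : 0 <= h -> N (flowX i h *m v) <= N v.
Proof.
move=> h0; pose A (_ : nat) := mxX R i; pose E (_ : nat) : R -> 'M[R]_4 := flowX i.
(* A positive step length even for [h = 0], with [h] inside the first step. *)
pose b (k : nat) := k%:R * (h + 1).
have h1 : 0 < h + 1 by rewrite ltr_wpDl.
have fE k : flow (A k) (E k) by exact: flowX_flow.
have AAA k : hullX R (A k) by exact: hullX_mxX.
have b0 : b 0%N = 0 by rewrite /b mul0r.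
have bS k : b k <= b k.+1 by rewrite /b ler_pM2r // ler_nat.
have binf t : exists k, t < b k.+1.
  exists (Num.truncn (`|t| / (h + 1))); rewrite /b -ltr_pdivrMr //.
  apply: le_lt_trans (truncnS_gt _).
  by rewrite ler_pM2r ?invr_gt0 // ler_norm.
have tx := step_trajectory v AAA fE b0 bS binf.
have := N_traj tx (lexx 0) h0; rewrite (step_traj0 v fE b0 bS binf).
rewrite (@step_trajE _ _ _ _ _ v fE b0 bS binf 0%N) ?b0 ?subr0 //.
by rewrite /b mul1r lerDl.
Qed.

Lemma barabanov_norm_prop : exists2 c : R, 0 < c & forall v, N v = c * bar v.
Proof.
pose f a := N (pr a 0); pose w0 := switch_pt m.
have fE := @planar_extremal_unique _ _ _ m01 lE slope f.
pose c := f w0 / nB w0.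
have {}fE a : f a = c * nB a.
  apply: fE => [s a'|i t a' t0].
    by rewrite /f -(is_normZ nN) prZ scaler0.
  by have := N_flowX i (pr a' 0) t0; rewrite flowX_pr mulmx0 scaler0.
have w00 : w0 != 0.
  by apply/eqP => /colP /(_ 0); rewrite !mxE /= => /eqP; rewrite oner_eq0.
have c0 : 0 < c.
  rewrite divr_gt0 ?(is_norm_gt0 nBN) // (is_norm_gt0 nN) //.
  by apply: contra w00 => /eqP /(congr1 (@up R)); rewrite up_pr => ->; apply/eqP; exact: raddf0.
have [D D0 ND] := is_norm_le_norm nN.
have Ndn a : N (pr 0 a) <= D * nB a.
  apply: le_trans (ND _) _; rewrite ler_pM2l //.
  apply: le_trans (norm_le_planar_norm m01 lE slope a).
  rewrite [leLHS]/Num.Def.normr /= mx_normrE; apply: bigmax_le => // -[i j] _ /=.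
  rewrite (ord1 j); case: (@split_ordP 2 2 i) => i' ->.
    have -> : pr 0 a (lshift 2 i') 0 = (0 : 'cV[R]_2) i' 0 by exact: (@col_mxEu _ 2 2 1).
    by rewrite mxE normr0.
  have -> : pr 0 a (rshift 2 i') 0 = a i' 0 by exact: (@col_mxEd _ 2 2 1).
  exact: coord_le_norm.
have split v : v = pr (up v) 0 + pr 0 (dn v) by rewrite prD addr0 add0r -prE.
exists c => // u; apply/eqP; rewrite eq_le; apply/andP; split.
  apply/ler_addgt0Pr => eps eps0.
  case: bN => _ /(_ u) [x tx [x0 [k kE]]].
  (* The trajectory realizing [N u] is not explicit, but [N] is constant along it, so one time at
     which its lower component is small suffices. *)
  have [t t0 dt] := dn_liminf m01 lE slope tx (divr_gt0 eps0 D0).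
  have -> : N u = N (x t).
    have := kE t t0; have := kE 0 (lexx 0).
    by rewrite lyapunov_hullX !mulr0 oppr0 expR0 !mul1r x0 => -> ->.
  rewrite [x t]split; apply: le_trans (is_normD nN _ _) _; apply: lerD.
    rewrite -/(f (up (x t))) fE ler_pM2l //.
    apply: le_trans (up_le_bar_norm m01 lE slope _) _.
    by rewrite -x0; exact: (bar_norm_trajectory m01 lE slope).
  apply: le_trans (Ndn _) _; rewrite mulrC -ler_pdivlMr //; exact: ltW.
apply/ler_addgt0Pr => eps eps0.
have [t0 /andP[t00 _] [uE _]] := bar_norm_attained m01 lE slope u.
have [x [tx x0 xup [K K0 xdn]]] := optimal_trajectory u t00.
(* Then [D * K = eps * s <= eps * e^s], so after time [t0 + s] the lower component costs at most
   [eps]. *)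
pose s := D * K / eps; have s0 : 0 <= s.
  by rewrite divr_ge0 ?mulr_ge0 // ltW.
pose t := t0 + s; have tt : t0 <= t by rewrite lerDl.
have h1 : N (x t) <= N u by rewrite -x0; apply: N_traj => //; exact: le_trans tt.
have h2 : c * bar u <= N (x t) + N (pr 0 (dn (x t))).
  rewrite /bar uE -(xup t tt) -fE /f.
  have -> : pr (up (x t)) 0 = x t - pr 0 (dn (x t)).
    by rewrite {2}[x t]split addrK.
  by apply: le_trans (is_normD nN _ _) _; rewrite (is_normN nN).
apply: le_trans h2 _; apply: lerD => //.
apply: le_trans (Ndn _) _.
apply: (@le_trans _ _ (D * (K * expR (- s)))).
  by rewrite ler_pM2l //; have := xdn t tt; rewrite /t addrC addrK.
rewrite expRN mulrA ler_pdivrMr ?expR_gt0 //.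
have := ler_wpM2l (ltW eps0) (expR_ge1Dx s).
have -> : D * K = eps * s by rewrite /s [RHS]mulrC divfK // gt_eqF.
by rewrite mulrDr mulr1; lra.
Qed.

End Unique.

Lemma bar_not_strictly_convex N : barabanov_norm (hullX R) N -> ~ strictly_convex N.
Proof.
move=> /barabanov_norm_prop [c c0 NE] sc; apply: sc.
pose w0 := switch_pt m.
have w00 : w0 != 0.
  by apply/eqP => /colP /(_ 0); rewrite !mxE /= => /eqP; rewrite oner_eq0.
have n0 : 0 < c * nB w0 by rewrite mulr_gt0 // (is_norm_gt0 nBN).
pose a := (c * nB w0)^-1 *: w0.
have na : c * nB a = 1.
  rewrite /a (is_normZ nBN) gtr0_norm ?invr_gt0 // mulrCA mulVf // gt_eqF //.
(* The upper component stays equal to [a] on this segment and the lower one is [s *: a], which is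
   inside the flat region of [bar_norm_flat]. *)
exists (pr a 0), (pr a a); split.
  apply/eqP => /(congr1 (@dn R)); rewrite !dn_pr => a0.
  by move: na; rewrite -a0 (is_norm0 nBN) mulr0 => /eqP; rewrite eq_sym oner_eq0.
move=> s /andP[s0 s1].
have -> : (1 - s) *: pr a 0 + s *: pr a a = pr a (s *: a).
  by rewrite !prZ prD scaler0 add0r -scalerDl subrK scale1r.
have h : nB (dn (pr a (s *: a))) <= nB (up (pr a (s *: a))).
  rewrite dn_pr up_pr (is_normZ nBN) ger0_norm // ler_piMl //.
  exact: (is_norm_ge0 nBN).
by rewrite NE /bar (bar_norm_flat m01 lE slope h) up_pr.
Qed.

End BarabanovUniqueness.

(** * Irreducibility, and an energy identity for eigenvectors *)

Section Structure.
Variable R : realType.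

(** Write [C_0] and [C_1] as [5/4 q] minus and plus [3/4 sw], with [q] a quarter turn and [sw] the
    swap of coordinates. The difference of [X_1] and [X_0] gives [sw] on both planes; their sum, up
    to a scalar, gives [5/2 q] above and [5/2 q - 2] below. Conjugating by [sw] reverses [q], so
    adding the two results isolates the lower component. [X_2] then exchanges the planes, and [q]
    and [sw] generate a whole plane from one nonzero vector. *)
Lemma hullX_irreducible : irreducible (hullX R).
Proof.
move=> [V [/andP[V0 V4] inv]].
pose q (a : 'cV[R]_2) := qrot R *m a.
pose sw (a : 'cV[R]_2) := vec2 (a 1 0) (a 0 0).
have prN (a b : 'cV[R]_2) : - pr a b = pr (- a) (- b).
  by rewrite -scaleN1r prZ !scaleN1r.
have C0E a : cmx R false *m a = (- (3 / 4)) *: sw a + (5 / 4) *: q a.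
  rewrite [a]vec2E /q cmx_vec2 qrot_vec2 /sw !vec2_0 !vec2_1 !vec2Z vec2D.
  by congr vec2; field.
have C1E a : cmx R true *m a = (3 / 4) *: sw a + (5 / 4) *: q a.
  rewrite [a]vec2E /q cmx_vec2 qrot_vec2 /sw !vec2_0 !vec2_1 !vec2Z vec2D.
  by congr vec2; field.
have swsw a : sw (sw a) = a by rewrite /sw !vec2_0 !vec2_1 -vec2E.
have swq a : sw (q (sw a)) = - q a.
  have swE x y : sw (vec2 x y) = vec2 y x by rewrite /sw vec2_0 vec2_1.
  rewrite [a]vec2E swE /q !qrot_vec2 swE -[RHS]scaleN1r vec2Z.
  by congr vec2; ring.
have swZ (c : R) a : sw (c *: a) = c *: sw a by rewrite /sw !mxE vec2Z.
have swD a b : sw (a + b) = sw a + sw b by rewrite /sw !mxE vec2D.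
have inS a b : pr a b \in V -> pr (sw a) (sw b) \in V.
  move=> abV.
  have -> : pr (sw a) (sw b) =
    (2 / 3) *: (mxX R true *m pr a b - mxX R false *m pr a b).
    rewrite !mxX_pr !mulmxBl !C0E !C1E prN prD prZ.
    by congr pr; apply/colP => j; rewrite !mxE; field.
  by rewrite memvZ // memvB // inv //; exact: hullX_mxX.
have inY a b : pr a b \in V -> pr ((5 / 2) *: q a) ((5 / 2) *: q b - 2 *: b) \in V.
  move=> abV.
  have -> : pr ((5 / 2) *: q a) ((5 / 2) *: q b - 2 *: b) =
    mxX R true *m pr a b + mxX R false *m pr a b + (2 * lam R) *: pr a b.
    rewrite !mxX_pr !mulmxBl !C0E !C1E !mul_scalar_mx prZ !prD.
    by congr pr; apply/colP => j; rewrite !mxE; field.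
  by rewrite memvD ?memvZ // memvD // inv //; exact: hullX_mxX.
have inDn a b : pr a b \in V -> pr 0 b \in V.
  move=> abV; have := inS _ _ (inY _ _ (inS _ _ abV)).
  rewrite swZ swq.
  have -> : sw ((5 / 2) *: q (sw b) - 2 *: sw b) = - ((5 / 2) *: q b) - 2 *: b.
    by rewrite -[X in sw (_ + X)]scaleNr swD !swZ swq swsw scalerN scaleNr.
  move=> h; have -> : pr 0 b = (- (1 / 4)) *:
    (pr ((5 / 2) *: q a) ((5 / 2) *: q b - 2 *: b) +
     pr ((5 / 2) *: - q a) (- ((5 / 2) *: q b) - 2 *: b)).
    by rewrite prD prZ; congr pr; apply/colP => j; rewrite !mxE; field.
  by rewrite memvZ // memvD // inY.
have inUp a b : pr a b \in V -> pr a 0 \in V.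
  move=> abV; have -> : pr a 0 = pr a b - pr 0 b.
    by rewrite prN prD oppr0 addr0 subrr.
  by rewrite memvB // (inDn a).
have inK a b : pr a b \in V -> pr b (- a) \in V.
  move=> abV; have -> : pr b (- a) = mxX2 R *m pr a b + pr a b.
    by rewrite mxX2_mxK mulmxBl mul1mx subrK mxK_pr.
  by rewrite memvD // inv //; exact: hullX_mxX2.
have inQ a : pr a 0 \in V -> pr (q a) 0 \in V.
  move=> /inY /inUp h; have -> : pr (q a) 0 = (2 / 5) *: pr ((5 / 2) *: q a) 0.
    by rewrite prZ scaler0 scalerA (_ : 2 / 5 * (5 / 2) = 1 :> R) ?scale1r //; field.
  by rewrite memvZ.
have sw0 : sw 0 = 0 by rewrite /sw !mxE; apply/colP => -[[|[|//]] ?]; rewrite !mxE.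
have inS0 a : pr a 0 \in V -> pr (sw a) 0 \in V.
  by move=> /inS; rewrite sw0.
have [a a0 aV] : exists2 a, a != 0 & pr a 0 \in V.
  have VN : V != 0%VS by rewrite -dimv_eq0 -lt0n.
  have vV := memv_pick V; have v0 : vpick V != 0 by rewrite vpick0.
  set v := vpick V in vV v0; rewrite [v]prE in vV.
  have [u0|u0] := eqVneq (up v) 0; last by exists (up v) => //; exact: inUp vV.
  exists (dn v); last by exact: inUp (inK _ _ vV).
  by apply: contra v0 => /eqP d0; rewrite [v]prE u0 d0 pr0.
have e1 (x y : R) : pr (vec2 x y) 0 \in V -> x != 0 -> forall c d : R, pr (vec2 c d) 0 \in V.
  move=> xyV x0 c d.
  (* Adding the quarter turn and the swap cancels the first coordinate. *)
  have h1 : pr (vec2 0 (2 * x)) 0 \in V.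
    have -> : pr (vec2 0 (2 * x)) 0 = pr (q (vec2 x y)) 0 + pr (sw (vec2 x y)) 0.
      rewrite prD addr0 /q /sw qrot_vec2 vec2_0 vec2_1 vec2D.
      by congr (pr (vec2 _ _) 0); ring.
    by rewrite memvD ?inQ ?inS0.
  have h2 := inS0 _ h1; rewrite /sw vec2_0 vec2_1 in h2.
  have -> : pr (vec2 c d) 0 = (c / (2 * x)) *: pr (vec2 (2 * x) 0) 0 +
     (d / (2 * x)) *: pr (vec2 0 (2 * x)) 0.
    rewrite !prZ prD !scaler0 addr0 !vec2Z vec2D.
    by congr (pr (vec2 _ _) 0); field.
  by rewrite memvD // memvZ.
have full a' : pr a' 0 \in V.
  rewrite [a']vec2E; rewrite [a]vec2E in aV a0.
  have [x0|x0] := eqVneq (a 0 0) 0; last exact: e1 aV x0 _ _.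
  have := inS0 _ aV; rewrite /sw vec2_0 vec2_1 => h; apply: (e1 _ _ h).
  apply: contra a0 => /eqP y0; rewrite x0 y0.
  by apply/eqP/colP => -[[|[|//]] ?]; rewrite !mxE.
have Vfull : V = fullv.
  apply/eqP; rewrite eqEsubv subvf /=; apply/subvP => v _; rewrite [v]prE.
  have -> : pr (up v) (dn v) = pr (up v) 0 + pr 0 (- - dn v).
    by rewrite prD addr0 add0r opprK.
  by rewrite memvD ?inK.
by move: V4; rewrite Vfull dimvf dim_matrix.
Qed.

(** Pair each equation with its own unknown, weighted by [P] or [Q]. The condition on [P] and [Q]
    makes the [p], [q] part skew, the coupling [g] is skew anyway, and [b] cancels between real and
    imaginary parts. What remains is [(a + D) V1 + (a + D') V2 = 0] with positive coefficients. *)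
Lemma tensor_energy (D D' P Q p q g a b x0 x1 x2 x3 y0 y1 y2 y3 : R) :
  0 < D -> 0 < D' -> 0 < P -> 0 < Q -> P * q = Q * p -> 0 <= a ->
  - D * x0 + q * x1 - g * x2 = a * x0 - b * y0 ->
  - p * x0 - D * x1 - g * x3 = a * x1 - b * y1 ->
  g * x0 - D' * x2 + q * x3 = a * x2 - b * y2 ->
  g * x1 - p * x2 - D' * x3 = a * x3 - b * y3 ->
  - D * y0 + q * y1 - g * y2 = b * x0 + a * y0 ->
  - p * y0 - D * y1 - g * y3 = b * x1 + a * y1 ->
  g * y0 - D' * y2 + q * y3 = b * x2 + a * y2 ->
  g * y1 - p * y2 - D' * y3 = b * x3 + a * y3 ->
  [/\ x0 = 0, x1 = 0, x2 = 0 & x3 = 0] /\ [/\ y0 = 0, y1 = 0, y2 = 0 & y3 = 0].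
Proof.
move=> D0 D'0 P0 Q0 PQ a0 e0 e1 e2 e3 f0 f1 f2 f3.
pose V1 := P * (x0 ^+ 2 + y0 ^+ 2) + Q * (x1 ^+ 2 + y1 ^+ 2).
pose V2 := P * (x2 ^+ 2 + y2 ^+ 2) + Q * (x3 ^+ 2 + y3 ^+ 2).
have E : (a + D) * V1 + (a + D') * V2 = 0.
  rewrite /V1 /V2.
  have k0 := congr1 ( *%R (P * x0)) e0; have k1 := congr1 ( *%R (Q * x1)) e1.
  have k2 := congr1 ( *%R (P * x2)) e2; have k3 := congr1 ( *%R (Q * x3)) e3.
  have j0 := congr1 ( *%R (P * y0)) f0; have j1 := congr1 ( *%R (Q * y1)) f1.
  have j2 := congr1 ( *%R (P * y2)) f2; have j3 := congr1 ( *%R (Q * y3)) f3.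
  have c := congr1 ( *%R (x0 * x1 + x2 * x3 + y0 * y1 + y2 * y3)) PQ.
  lra.
have s (z : R) : 0 <= z ^+ 2 := sqr_ge0 z.
have V10 : 0 <= V1 by rewrite addr_ge0 // mulr_ge0 ?addr_ge0 // ltW.
have V20 : 0 <= V2 by rewrite addr_ge0 // mulr_ge0 ?addr_ge0 // ltW.
have V1E : V1 = 0 by nra.
have V2E : V2 = 0 by nra.
have sq0 (z : R) : z ^+ 2 <= 0 -> z = 0.
  by move=> h; apply/eqP; rewrite -sqrf_eq0 eq_le h s.
rewrite /V1 in V1E; rewrite /V2 in V2E.
split; split; apply: sq0; nra.
Qed.

End Structure.

(** * Spectrum of the elements of the hull, and the theorem *)

Section Hurwitz.
Variable R : realType.

Lemma hullX_comb X : hullX R X -> exists a b c : R,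
  [/\ 0 <= a, 0 <= b, 0 <= c & a + b + c = 1] /\
  X = a *: mxX R false + b *: mxX R true + c *: mxX2 R.
Proof.
apply: (hullX_ind (P := fun X => exists a b c : R,
  [/\ 0 <= a, 0 <= b, 0 <= c & a + b + c = 1] /\
  X = a *: mxX R false + b *: mxX R true + c *: mxX2 R)) => [[]||A B s /andP[s0 s1]].
- by exists 0, 1, 0; rewrite !scale0r scale1r !add0r !addr0.
- by exists 1, 0, 0; rewrite !scale0r scale1r !addr0.
- by exists 0, 0, 1; rewrite !scale0r scale1r !add0r.
move=> [a [b [c [[a0 b0 c0 abc] ->]]]] [a' [b' [c' [[a0' b0' c0' abc'] ->]]]].
have s1' : 0 <= 1 - s by rewrite subr_ge0.
exists (s * a + (1 - s) * a'), (s * b + (1 - s) * b'), (s * c + (1 - s) * c').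
split; last first.
  move: (mxX R false) (mxX R true) (mxX2 R) => U V W.
  by apply/matrixP => i j; rewrite !mxE; ring.
split; rewrite ?addr_ge0 ?mulr_ge0 //.
have -> : s * a + (1 - s) * a' + (s * b + (1 - s) * b') + (s * c + (1 - s) * c') =
  s * (a + b + c) + (1 - s) * (a' + b' + c') by ring.
by rewrite abc abc'; ring.
Qed.

(** A real matrix acts separately on real and imaginary parts; rows appear because [eigenvalue]
    refers to left eigenvectors. *)
Lemma row_eigen_real n (X : 'M[R]_n) (v : 'rV[R[i]]_n) (z : R[i]) j :
  v *m map_mx (real_complex R) X = z *: v ->
  \sum_i complex.Re (v 0 i) * X i j =
    complex.Re z * complex.Re (v 0 j) - complex.Im z * complex.Im (v 0 j) /\
  \sum_i complex.Im (v 0 i) * X i j =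
    complex.Im z * complex.Re (v 0 j) + complex.Re z * complex.Im (v 0 j).
Proof.
move=> /matrixP /(_ 0 j); rewrite !mxE => e.
have ReD : {morph (@complex.Re R) : x y / x + y} by move=> [? ?] [? ?].
have ImD : {morph (@complex.Im R) : x y / x + y} by move=> [? ?] [? ?].
have sRe : \sum_i complex.Re (v 0 i) * X i j =
    complex.Re (\sum_i v 0 i * map_mx (real_complex R) X i j).
  rewrite (big_morph _ ReD (erefl : complex.Re 0 = 0)); apply: eq_bigr => i _.
  by rewrite !mxE; case: (v 0 i) => x y /=; rewrite mulr0 subr0.
have sIm : \sum_i complex.Im (v 0 i) * X i j =
    complex.Im (\sum_i v 0 i * map_mx (real_complex R) X i j).
  rewrite (big_morph _ ImD (erefl : complex.Im 0 = 0)); apply: eq_bigr => i _.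
  by rewrite !mxE; case: (v 0 i) => x y /=; rewrite mulr0 add0r mulrC.
rewrite sRe sIm e; case: z {e} => a b; case: (v 0 j) => x y /=.
by split=> //; rewrite addrC.
Qed.

Lemma sum4 (F : 'I_4 -> R) :
  \sum_i F i = F (inord 0) + F (inord 1) + F (inord 2) + F (inord 3).
Proof.
rewrite !big_ord_recl big_ord0 addr0 !addrA.
by congr (F _ + F _ + F _ + F _); apply/val_inj; rewrite /= inordK.
Qed.

Lemma hullX_hurwitz X : 0 < lam R -> hullX R X -> hurwitz X.
Proof.
move=> l0 /hullX_comb [a [b [c [[a0 b0 c0 abc] XE]]]] z.
case/eigenvalueP => v ev v0; rewrite ltNge; apply/negP => z0.
pose x k := complex.Re (v 0 (inord k)); pose y k := complex.Im (v 0 (inord k)).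
pose D := (a + b) * lam R + c; pose D' := (a + b) * (lam R + 1) + c.
pose p := 2 * a + b / 2; pose q := a / 2 + 2 * b.
have D0 : 0 < D.
  have [s0|s0] := leP (a + b) 0; first by rewrite /D; nra.
  by rewrite /D ltr_pwDl // mulr_gt0.
have D'0 : 0 < D' by rewrite /D' /D in D0 *; nra.
(* The planar part has off-diagonal entries [- p] and [q], so the weights [p] and [q] themselves
   work; when only [X_2] is present both entries vanish and any positive weights do. *)
have [P [Q [P0 Q0 PQ]]] : exists P Q, [/\ 0 < P, 0 < Q & P * q = Q * p].
  have [s0|s0] := leP (a + b) 0.
    exists 1, 1; split=> //; have -> : q = 0 by rewrite /q; lra.
    by have -> : p = 0 by rewrite /p; lra.
  exists p, q; split; rewrite ?/p ?/q; [lra|lra|exact: mulrC].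
have E j : _ := row_eigen_real (inord j) ev.
have X0 := E 0%N; have X1 := E 1%N; have X2 := E 2%N; have X3 := E 3%N.
move: X0 X1 X2 X3; rewrite !sum4 XE /mxX mxX0E mxX1E mxX2E !mxE !inordK //=.
rewrite -/(x 0%N) -/(x 1%N) -/(x 2%N) -/(x 3%N) -/(y 0%N) -/(y 1%N) -/(y 2%N) -/(y 3%N).
move=> [e0 f0] [e1 f1] [e2 f2] [e3 f3].
have [||||||||[x0 x1 x2 x3] [y0 y1 y2 y3]] := @tensor_energy R D D' P Q p q c
  (complex.Re z) (complex.Im z) (x 0%N) (x 1%N) (x 2%N) (x 3%N)
  (y 0%N) (y 1%N) (y 2%N) (y 3%N) D0 D'0 P0 Q0 PQ z0.
- by rewrite -e0 /D /q; ring.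
- by rewrite -e1 /D /p; ring.
- by rewrite -e2 /D' /q; ring.
- by rewrite -e3 /D' /p; ring.
- by rewrite -f0 /D /q; ring.
- by rewrite -f1 /D /p; ring.
- by rewrite -f2 /D' /q; ring.
- by rewrite -f3 /D' /p; ring.
have vk k : x k = 0 -> y k = 0 -> v 0 (inord k) = 0.
  by rewrite /x /y; case: (v 0 (inord k)) => r s /= -> ->.
case/eqP: v0; apply/rowP => k; rewrite mxE -(inord_val k).
by case: k => -[|[|[|[|//]]]] ? /=; apply: vk.
Qed.

Lemma lam_slope : exists m : R, [/\ 0 < m < 1, lam R = 5 / 2 * m / (1 - m ^+ 2) &
  2 * lam R * (atan (2 * m)^-1 + atan (m / 2)) =
  ln (4 + m ^+ 2) - ln (1 + 4 * m ^+ 2)].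
Proof.
have [m m01 slope] := switching_slope_exists R; exists m.
by have e := lam_eq m01 erefl slope; rewrite e.
Qed.

End Hurwitz.

Theorem theorem1 (R : realType) :
  [/\ irreducible (hullX R),
      marginally_stable (hullX R) &
      forall X, hullX R X -> hurwitz X] /\
  [/\ exists N : 'cV[R]_4 -> R, barabanov_norm (hullX R) N,
      forall N N' : 'cV[R]_4 -> R,
        barabanov_norm (hullX R) N -> barabanov_norm (hullX R) N' ->
        exists2 c : R, 0 < c & forall v, N' v = c * N v &
      forall N : 'cV[R]_4 -> R,
        barabanov_norm (hullX R) N -> ~ strictly_convex N].
Proof.
have [m [m01 lE slope]] := lam_slope R; split; split.
- exact: hullX_irreducible.
- exact: marginally_stable_hullX m01 lE slope.
- by move=> X; apply: hullX_hurwitz; exact: rate_gt0 m01 lE.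
- by exists (@bar_norm R); exact: bar_barabanov m01 lE slope.
- move=> N N' bN bN'.
  have [c c0 NE] := barabanov_norm_prop m01 lE slope bN.
  have [c' c0' NE'] := barabanov_norm_prop m01 lE slope bN'.
  exists (c' / c) => [|v]; first exact: divr_gt0.
  by rewrite NE NE' mulrA divfK // gt_eqF.
- exact: bar_not_strictly_convex m01 lE slope.
Qed.
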